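(* Let $G$ be a homogeneous group of homogeneous dimension $Q$. For $\sigma\in\mathbb{Z}$ and $I>0$ define $\Phi^I_\sigma(x)=(1+2^\sigma|x|)^{-I}$ for $x\in G$. Say $J>0$, and let $I=J+Q$. Then there exists $C>0$ such that whenever $\sigma,\nu\in\mathbb{Z}$ with $\sigma\ge\nu$, $$\Phi^I_\sigma\ast\Phi^J_\nu\le C\,2^{-\sigma Q}\,\Phi^J_\nu$$ pointwise on $G$.
   Context: A homogeneous group $G$ is a connected, simply connected nilpotent Lie group with underlying manifold $\mathbb{R}^n$ whose Lie algebra $\mathfrak{g}$ is endowed with a family of dilations $\{\delta_r\}_{r>0}$ (diagonalizable linear maps $\delta_r=\exp(A\log r)$, $A$ diagonalizable with positive eigenvalues) which are automorphisms of $\mathfrak{g}$. $G$ is identified with $\mathfrak{g}\cong\mathbb{R}^n$ by the exponential map, so that the group dilations are $\delta_r(x_1,\dots,x_n)=(r^{a_1}x_1,\dots,r^{a_n}x_n)$, with $1=a_1\le\dots\le a_n$. The homogeneous dimension is $Q=\sum_{i=1}^n a_i$. Haar measure on $G$ is Lebesgue measure. A homogeneous norm $|\cdot|:G\to[0,\infty)$ is fixed: it is continuous, smooth away from the origin, and satisfies $|x|=0$ iff $x$ is the identity, $|x^{-1}|=|x|$, and $|\delta_r(x)|=r|x|$ for $r>0$. $\ast$ is group convolution: $(f\ast g)(x)=\int_G f(xy^{-1})g(y)\,dy=\int_G f(y)g(y^{-1}x)\,dy$. *)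

(* Defs.v *)
From HB Require Import structures.
From mathcomp Require Import all_boot all_order all_algebra.
From mathcomp Require Import all_classical all_reals all_analysis.
Set Implicit Arguments.
Unset Strict Implicit.
Unset Printing Implicit Defensive.
Import Order.TTheory GRing.Theory Num.Theory.
Import numFieldNormedType.Exports.

Local Open Scope classical_set_scope.
Local Open Scope ring_scope.

Fact borel_row_display : measure_display.
Proof. exact: default_measure_display. Qed.

(* 'rV[R]_n carries the product of the Borel sigma-algebras of R, as the
   library does for n.-tuple; this is the Borel sigma-algebra of R^n. *)
Section measurable_row.
Variables (R : realType) (n : nat).

Let coors : 'I_n -> 'rV[R]_n -> measurableTypeR R := fun i x => x 0 i.

Let row_set0 : g_sigma_preimage coors set0.
Proof. exact: sigma_algebra0. Qed.

Let row_setC A : g_sigma_preimage coors A -> g_sigma_preimage coors (~` A).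
Proof. exact: sigma_algebraC. Qed.

Let row_bigcup (F : _^nat) : (forall i, g_sigma_preimage coors (F i)) ->
  g_sigma_preimage coors (\bigcup_i (F i)).
Proof. exact: sigma_algebra_bigcup. Qed.

HB.instance Definition _ := @isMeasurable.Build
  borel_row_display
  'rV[R]_n (g_sigma_preimage coors) row_set0 row_setC row_bigcup.

End measurable_row.

Section measurable_fun_row.
Variable R : realType.

Lemma measurable_coord n (i : 'I_n) :
  measurable_fun [set: 'rV[R]_n]
    (fun x : 'rV[R]_n => x 0 i : measurableTypeR R).
Proof.
move=> _ Y mY; rewrite setTI; apply: sub_sigma_algebra => /=.
rewrite -bigcup_seq/=; exists i => /=; first by rewrite mem_index_enum.
by exists Y => //; rewrite setTI.
Qed.

Lemma measurable_fun_row d (T : measurableType d) n (f : T -> 'rV[R]_n) :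
  (forall i, measurable_fun [set: T]
     (fun t => f t 0 i : measurableTypeR R)) ->
  measurable_fun [set: T] f.
Proof.
move=> mf; apply: (@measurability _ _ T 'rV[R]_n setT f (\big[setU/set0]_(i < n)
  preimage_set_system setT (fun x : 'rV[R]_n => x 0 i : measurableTypeR R)
    measurable)) => //.
move=> _ [B + <-]; rewrite -bigcup_seq => -[i _ [C mC <-]].
by have := mf i measurableT C mC; rewrite !setTI.
Qed.

End measurable_fun_row.

Section lebesgue_row.
Variable R : realType.
Local Open Scope ereal_scope.

Definition row_cons n (p : measurableTypeR R * 'rV[R]_n) : 'rV[R]_n.+1 :=
  row_mx (p.1%:M : 'rV_1) p.2.

Definition row_uncons n (x : 'rV[R]_n.+1) : measurableTypeR R * 'rV[R]_n :=
  (x 0%R ord0, rsubmx (x : 'rV_(1 + n))).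

Lemma row_cons0 n (p : measurableTypeR R * 'rV[R]_n) :
  row_cons p 0%R ord0 = p.1.
Proof.
have -> : (ord0 : 'I_n.+1) = lshift n (ord0 : 'I_1) by exact/val_inj.
by rewrite /row_cons (@row_mxEl _ 1 1 n) mxE eqxx mulr1n.
Qed.

Lemma row_consS n (p : measurableTypeR R * 'rV[R]_n) j :
  row_cons p 0%R (lift ord0 j) = p.2 0%R j.
Proof.
have -> : lift ord0 j = rshift 1 j by exact/val_inj.
by rewrite /row_cons (@row_mxEr _ 1 1 n).
Qed.

Lemma row_consK n : cancel (@row_cons n) (@row_uncons n).
Proof. by move=> [x v]; rewrite /row_uncons row_cons0 row_mxKr. Qed.

Lemma measurable_row_cons n : measurable_fun setT (@row_cons n).
Proof.
apply: measurable_fun_row => i; case: (unliftP ord0 i) => [j ->|->].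
- under eq_fun do rewrite row_consS.
  exact: measurableT_comp (measurable_coord j) measurable_snd.
- by under eq_fun do rewrite row_cons0; exact: measurable_fst.
Qed.

Lemma measurable_row_uncons n : measurable_fun setT (@row_uncons n).
Proof.
apply: measurable_fun_pair; first exact: measurable_coord.
apply: measurable_fun_row => i; under eq_fun do rewrite mxE.
exact: measurable_coord.
Qed.

Section step.
Variables (n : nat) (mu : {sigma_finite_measure set 'rV[R]_n -> \bar R}).

Definition lebesgue_row_step :=
  pushforward (@lebesgue_measure R \x mu) (@row_cons n).

Let step0 : lebesgue_row_step set0 = 0.
Proof. by rewrite /lebesgue_row_step measure0 //; exact: measurable_row_cons. Qed.

Let step_ge0 A : 0 <= lebesgue_row_step A.
Proof. by apply: measure_ge0; exact: measurable_row_cons. Qed.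

Let step_sigma_additive : semi_sigma_additive lebesgue_row_step.
Proof. by apply: measure_semi_sigma_additive; exact: measurable_row_cons. Qed.

HB.instance Definition _ := isMeasure.Build _ _ _ lebesgue_row_step
  step0 step_ge0 step_sigma_additive.

Let sigma_finite_step : sigma_finite setT lebesgue_row_step.
Proof.
have /sigma_finiteP[F [FT ndF Foo]] := sigma_finiteT (@lebesgue_measure R).
have /sigma_finiteP[G [GT ndG Goo]] := sigma_finiteT mu.
exists (fun k => @row_uncons n @^-1` (F k `*` G k)).
  apply/seteqP; split => // x _.
  have [i _ Fi] : (\bigcup_k F k) (row_uncons x).1 by rewrite -FT.
  have [j _ Gj] : (\bigcup_k G k) (row_uncons x).2 by rewrite -GT.
  exists (maxn i j) => //; split => /=.
    by move: Fi; exact/subsetPset/ndF/leq_maxl.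
  by move: Gj; exact/subsetPset/ndG/leq_maxr.
move=> k; have [mF Fk] := Foo k; have [mG Gk] := Goo k; split.
  rewrite -[X in measurable X]setTI.
  by apply: measurable_row_uncons => //; exact: measurableX.
rewrite /lebesgue_row_step /pushforward -comp_preimage.
rewrite (_ : _ \o _ = idfun) ?preimage_id; last first.
  by apply/funext => p /=; rewrite row_consK.
by rewrite product_measure1E// lte_mul_pinfty// ge0_fin_numE.
Qed.

HB.instance Definition _ :=
  @Measure_isSigmaFinite.Build _ _ _ lebesgue_row_step sigma_finite_step.

End step.

(* Through R^(n+1) = R * R^n; lebesgue_row_box gives the value on boxes. *)
Fixpoint lebesgue_row (n : nat) : {sigma_finite_measure set 'rV[R]_n -> \bar R} :=
  match n with
  | 0 => \d_(0%R : 'rV[R]_0)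
  | m.+1 => lebesgue_row_step (lebesgue_row m)
  end.

Lemma lebesgue_row_box n (A : 'I_n -> set (measurableTypeR R)) :
  (forall i, measurable (A i)) ->
  lebesgue_row n [set x | forall i, A i (x 0%R i)] =
  \prod_(i < n) lebesgue_measure (A i).
Proof.
elim: n A => [|n IH] A mA.
  rewrite big_ord0 /= diracE mem_set//= => i; by case: i.
rewrite big_ord_recl /= /lebesgue_row_step /pushforward.
have mB : measurable [set x : 'rV[R]_n | forall i, A (lift ord0 i) (x 0%R i)].
  rewrite (_ : mkset _ = \bigcap_(i in [set: 'I_n])
    (fun x : 'rV[R]_n => x 0%R i : measurableTypeR R) @^-1` A (lift ord0 i)).
    apply: fin_bigcap_measurable => // i _.
    by rewrite -[X in measurable X]setTI; exact: measurable_coord.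
  by apply/seteqP; split => x /=; [move=> h i _; exact: h|move=> h i; exact: h].
rewrite -(IH (fun i => A (lift ord0 i))) // -product_measure1E //.
congr (_ _); apply/seteqP; split => -[x v] /=.
  by move=> h; split => [|i]; [have := h ord0; rewrite row_cons0|
    have := h (lift ord0 i); rewrite row_consS].
move=> [h1 h2] i; case: (unliftP ord0 i) => [j ->|->].
  by rewrite row_consS.
by rewrite row_cons0.
Qed.

End lebesgue_row.

Section smooth.
Variables (R : realType) (V W : normedModType R).

(* For U open and V finite-dimensional, this is the usual class C^k(U). *)
Fixpoint Ck_on (k : nat) (U : set V) (f : V -> W) : Prop :=
  (forall x, U x -> {for x, continuous f}) /\
  match k with
  | 0 => True
  | m.+1 => forall v, (forall x, U x -> derivable f x v) /\
                      Ck_on m U (fun x => 'D_v f x)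
  end.

Definition smooth_on (U : set V) (f : V -> W) : Prop :=
  forall k, Ck_on k U f.

End smooth.

Section lie_group.
Variables (R : realType) (m : nat).
Local Notation V := 'rV[R]_m.

Record is_lie_group (mul : V -> V -> V) (inv : V -> V) (e : V) : Prop := {
  lie_mulA : associative mul;
  lie_mul1 : left_id e mul;
  lie_mulV : left_inverse e inv mul;
  lie_mul_smooth : smooth_on [set: V * V] (fun p => mul p.1 p.2);
  lie_inv_smooth : smooth_on [set: V] inv
}.

(* The Lie algebra is R^m, the tangent space at the identity e: u stands for
   the left-invariant vector field x |-> d/dt x (e + t u) at t = 0, and the
   bracket is the value at e of the bracket of vector fields. *)
Definition left_invariant_field (mul : V -> V -> V) (e u : V) : V -> V :=
  fun x => 'D_u (mul x) e.

Definition field_bracket (X Y : V -> V) : V -> V :=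
  fun x => 'D_(X x) Y x - 'D_(Y x) X x.

Definition lie_bracket (mul : V -> V -> V) (e u v : V) : V :=
  field_bracket (left_invariant_field mul e u) (left_invariant_field mul e v) e.

(* The lower central series terminates: all brackets
   [u_1, [u_2, ... [u_s, v]]] of some fixed length vanish. *)
Definition nilpotent_lie_algebra (br : V -> V -> V) : Prop :=
  exists s : nat, forall (us : s.-tuple V) (v : V), foldr br v us = 0.

(* E is the exponential map: t |-> E (t u) is the one-parameter subgroup with
   initial velocity u. *)
Definition is_exponential_map (mul : V -> V -> V) (E : V -> V) : Prop :=
  forall u : V,
    (forall s t : R, E ((s + t) *: u) = mul (E (s *: u)) (E (t *: u))) /\
    is_derive (0 : R) (1 : R) (fun t : R => E (t *: u)) u.

Definition dilation (a : 'I_m -> R) (r : R) (x : V) : V :=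
  \row_i (r `^ a i * x 0 i).

End lie_group.

(* The dimension is n.+1, as 1 = a_1 forces it to be positive. *)
Record homogeneous_group (R : realType) (n : nat) := HomogeneousGroup {
  hg_mul : 'rV[R]_n.+1 -> 'rV[R]_n.+1 -> 'rV[R]_n.+1;
  hg_inv : 'rV[R]_n.+1 -> 'rV[R]_n.+1;
  hg_weight : 'I_n.+1 -> R;
  hg_lie_group : is_lie_group hg_mul hg_inv 0;
  hg_nilpotent : nilpotent_lie_algebra (lie_bracket hg_mul 0);
  (* the group is identified with its Lie algebra through exp *)
  hg_exp : is_exponential_map hg_mul id;
  hg_weight0 : hg_weight ord0 = 1;
  hg_weight_le : forall i j : 'I_n.+1, (i <= j)%N ->
    hg_weight i <= hg_weight j;
  (* dilations are linear bijections, so preserving the bracket makes them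
     automorphisms of the Lie algebra *)
  hg_dilation : forall r : R, 0 < r -> forall u v,
    dilation hg_weight r (lie_bracket hg_mul 0 u v) =
    lie_bracket hg_mul 0 (dilation hg_weight r u) (dilation hg_weight r v)
}.

Section homogeneous_group_theory.
Variables (R : realType) (n : nat) (G : homogeneous_group R n).
Local Notation V := 'rV[R]_n.+1.

Definition homogeneous_dim : R := \sum_i hg_weight G i.

Record is_homogeneous_norm (N : V -> R) : Prop := {
  hnorm_ge0 : forall x, 0 <= N x;
  hnorm_continuous : continuous N;
  hnorm_smooth : smooth_on [set x : V | x != 0] N;
  hnorm_eq0 : forall x, N x = 0 <-> x = 0;
  hnorm_inv : forall x, N (hg_inv G x) = N x;
  hnorm_dilation : forall r x, 0 < r -> N (dilation (hg_weight G) r x) = r * N x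
}.

(* Extended-real-valued, so that a bound from above includes convergence. *)
Definition convolution (f g : V -> R) (x : V) : \bar R :=
  (\int[lebesgue_row R n.+1]_y (f (hg_mul G x (hg_inv G y)) * g y)%:E)%E.

End homogeneous_group_theory.

Definition Phi (R : realType) (n : nat) (N : 'rV[R]_n.+1 -> R)
    (I : R) (sigma : int) (x : 'rV[R]_n.+1) : R :=
  (1 + 2%:R ^ sigma * N x) `^ (- I).

(* Main.v *)
From HB Require Import structures.
Require Import Defs.
From mathcomp Require Import all_boot all_order all_algebra.
From mathcomp Require Import all_classical all_reals all_analysis.
From mathcomp Require Import measurable_realfun ring lra.

(** Let Q be the homogeneous dimension and write z = x y^-1, so that x = z y. The
    homogeneous norm satisfies N x <= c (N z + N y) ([hnorm_quasi_triangle]), so one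
    of N y and N z is at least N x / 2c.

    Where N y is large, Phi_nu^J (y) is at most a constant times Phi_nu^J (x), and the
    integral of Phi_sigma^I (x y^-1) over y is at most a constant times 2^(- sigma Q),
    because I > Q ([integral_decay_le]). Where N z is large and N y is not,
    Phi_sigma^I (z) is at most a constant times (1 + 2^sigma N x)^(- I), Phi_nu^J (y) <= 1,
    and y ranges over a ball of volume at most a constant times (N x)^Q. Since
    I = J + Q, the product of the two is at most
    2^(- sigma Q) (1 + 2^sigma N x)^(- J) up to a constant, and sigma >= nu concludes
    ([convolution_decay_le]).

    Both the quasi-triangle inequality and the volume of the balls rest on the fact
    that dilations are automorphisms of the group, whereas they are only given as
    automorphisms of the Lie algebra. In exponential coordinates the left-translated
    differential F of t |-> exp (t u) in the direction t w solves F' = w - [u, F]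
    ([is_derive_exp_diff]), an equation which involves only the bracket; nilpotency
    makes its solution unique ([nilpotent_ode]). Hence a linear map
    that preserves the bracket preserves left-invariant fields, and is a group
    morphism ([exp_linear_mul]).

    Homogeneity of the group law then forces it to be triangular ([mul_triangular]):
    the i-th coordinate of x y is the i-th coordinate of y plus a function of x and
    of the earlier coordinates of y. This bounds the volume of
    {y : N (x y^-1) <= r} uniformly in x, coordinate after coordinate
    ([lebesgue_row_le], [hmul_ball_volume]). *)

Set Implicit Arguments.
Unset Strict Implicit.
Unset Printing Implicit Defensive.
Import Order.TTheory GRing.Theory Num.Theory.
Import numFieldNormedType.Exports.
Local Open Scope classical_set_scope.
Local Open Scope ring_scope.

(** * Continuous directional derivatives and differentiability *)
Section continuously_differentiable.
Variables (R : realType) (U : normedModType R).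

Lemma is_derive_line (W : normedModType R) (f : U -> W) (x v : U) (t : R) :
  derivable f (x + t *: v) v ->
  is_derive t 1 (fun s => f (x + s *: v)) ('D_v f (x + t *: v)).
Proof.
move=> df.
have e : (fun h : R => h^-1 *: (((fun s => f (x + s *: v)) \o shift t) (h *: 1) -
   f (x + t *: v))) = (fun h => h^-1 *: ((f \o shift (x + t *: v)) (h *: v) - f (x + t *: v))).
  apply/funext => h /=; congr (_ *: (f _ - _)).
  by rewrite [h *: 1]mulr1 scalerDl addrCA.
by split; rewrite /derivable /derive e.
Qed.

Lemma is_derive_lineP (W : normedModType R) (f : U -> W) (x v : U) (l : W) :
  is_derive (0 : R) (1 : R) (fun s : R => f (x + s *: v)) l -> is_derive x v f l.
Proof.
have e : (fun h : R => h^-1 *: (((fun s => f (x + s *: v)) \o shift (0:R)) (h *: 1) -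
   f (x + 0 *: v))) = (fun h => h^-1 *: ((f \o shift x) (h *: v) - f x)).
  apply/funext => h /=; congr (_ *: (f _ - f _)).
    by rewrite [h *: 1]mulr1 addr0 addrC.
  by rewrite scale0r addr0.
by case => d1 d2; split; move: d1 d2; rewrite /derivable /derive e.
Qed.

Variable f : U -> R.
Hypothesis df : forall v x, derivable f x v.
Hypothesis cf : forall v, continuous (fun x => 'D_v f x).

(** The mean value theorem along a segment needs only directional derivatives,
    and is what turns their continuity into linearity and differentiability. *)
Lemma mean_value_dir x v : exists2 t : R, 0 <= t <= 1 & f (x + v) - f x = 'D_v f (x + t *: v).
Proof.
have H (t : R) : is_derive t (1 : R) (fun s : R => f (x + s *: v)) ('D_v f (x + t *: v)).
  exact: is_derive_line.
have cf1 : {within `[0, 1], continuous (fun s : R => f (x + s *: v))}.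
  by apply: derivable_within_continuous => t _; have [] := H t.
have [t ht] := MVT_segment ler01 (fun t _ => H t) cf1.
rewrite scale1r scale0r addr0 subr0 mulr1 => e.
by exists t => //; move: ht; rewrite in_itv.
Qed.

Lemma derive_dirZ k x v : 'D_(k *: v) f x = k * 'D_v f x.
Proof.
apply: derive_val; apply: is_derive_lineP.
have H : is_derive (0 * k) (1 : R) (fun s : R => f (x + s *: v)) ('D_v f (x + 0 *: v)).
  by rewrite mul0r; exact: is_derive_line.
rewrite scale0r addr0 in H.
have -> : (fun s : R => f (x + s *: (k *: v))) = (fun s : R => f (x + s *: v)) \o (fun s => s * k).
  by apply/funext => s /=; rewrite scalerA.
have H2 : is_derive (0:R) (1:R) (fun s : R => s * k) k.
  by apply: trigger_derive; rewrite /GRing.scale/= !mulr0 mulr1 add0r.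
by rewrite mulrC; exact: (@is_derive1_comp R _ _ 0 _ _ H H2).
Qed.

(** Going from x to x + h (u + v) through x + h u, the second leg is, by the mean
    value theorem, h times the derivative in direction v at a point that tends
    to x with h; continuity of that derivative gives its limit. *)
Lemma derive_dirD x u v : 'D_(u + v) f x = 'D_u f x + 'D_v f x.
Proof.
(* tau h locates the mean value point on the second leg. *)
have [tau /all_and2[Htau Etau]] : {tau : R -> R & forall h,
   (0 <= tau h <= 1) /\ f (x + h *: u + h *: v) - f (x + h *: u) =
     'D_(h *: v) f (x + h *: u + tau h *: (h *: v))}.
  apply: (@choice _ _ (fun h t => (0 <= t <= 1) /\ f (x + h *: u + h *: v) - f (x + h *: u) =
     'D_(h *: v) f (x + h *: u + t *: (h *: v)))) => h.
  by have [t] := mean_value_dir (x + h *: u) (h *: v); exists t.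
have c1 : (h^-1 *: ((f \o shift x) (h *: (u + v)) - f x)) @[h --> 0^'] --> 'D_(u + v) f x.
  exact: df.
have c2 : (h^-1 *: ((f \o shift x) (h *: u) - f x)) @[h --> 0^'] --> 'D_u f x.
  exact: df.
have c3 : ('D_v f (x + h *: u + tau h *: (h *: v))) @[h --> 0^'] --> 'D_v f x.
  apply: (@cvg_comp _ _ _ (fun h => x + h *: u + tau h *: (h *: v)) (fun y => 'D_v f y) _ (nbhs x)); last exact: cf.
  apply/cvgrPdist_le => /= e e0.
  have d0 : 0 < e / (`|u| + `|v| + 1) by rewrite divr_gt0// ltr_wpDl ?addr_ge0.
  near=> h.
  rewrite -addrA opprD addrA subrr add0r normrN.
  rewrite (le_trans (ler_normD _ _))// !normrZ.
  apply: (@le_trans _ _ (`|h| * (`|u| + `|v| + 1))).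
    rewrite !mulrDr mulr1 -addrA lerD2l.
    rewrite (@le_trans _ _ (`|h| * `|v|)) ?lerDl// ler_piMl ?mulr_ge0//.
    by have /andP[? ?] := Htau h; rewrite ger0_norm.
  rewrite -ler_pdivlMr ?ltr_wpDl ?addr_ge0//.
  by near: h; exact: dnbhs0_le.
have c4 : (h^-1 *: ((f \o shift x) (h *: u) - f x) +
    'D_v f (x + h *: u + tau h *: (h *: v))) @[h --> 0^'] --> 'D_u f x + 'D_v f x.
  exact: cvgD c2 c3.
have qE : {near (0 : R)^', (fun h : R => h^-1 *: ((f \o shift x) (h *: u) - f x) +
    'D_v f (x + h *: u + tau h *: (h *: v))) =1
    (fun h : R => h^-1 *: ((f \o shift x) (h *: (u + v)) - f x))}.
  near=> h.
  have h0 : h != 0 by near: h; exact: (@nbhs_dnbhs_neq R (0:R)).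
  have -> : 'D_v f (x + h *: u + tau h *: (h *: v)) = h^-1 *: (f (x + h *: u + h *: v) - f (x + h *: u)).
    by rewrite Etau derive_dirZ /GRing.scale/= mulKf.
  rewrite -scalerDr; congr (_ *: _) => /=.
  by rewrite scalerDr addrC (addrC (h *: u) x) addrA [X in f X - f x]addrC addrA; ring.
have c5 : (h^-1 *: ((f \o shift x) (h *: (u + v)) - f x)) @[h --> 0^'] -->
    'D_u f x + 'D_v f x by exact: cvg_trans (near_eq_cvg qE) c4.
exact: (cvg_lim _ c5).
Unshelve. all: by end_near. Qed.

Variables (I : finType) (b : I -> U) (c : I -> U -> R).
Hypothesis bc : forall v, v = \sum_i c i v *: b i.
Hypothesis ble : forall i v, `|c i v| <= `|v|.

Lemma derive_dir_sum x v : 'D_v f x = \sum_i c i v * 'D_(b i) f x.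
Proof.
rewrite [in LHS](bc v).
elim/big_rec2 : _ => [|i y1 y2 _ <-]; first by rewrite derive0.
by rewrite derive_dirD derive_dirZ.
Qed.

(** Continuous directional derivatives are stated one direction at a time; a finite
    coordinate system makes the continuity uniform over directions, since only
    the derivatives along the [b i] have to be controlled. *)
Lemma C1_differentiable_scalar x : differentiable f x.
Proof.
pose d v := 'D_v f x.
have dl : linear d.
  by move=> k u v; rewrite /d derive_dirD derive_dirZ.
pose dM := GRing.isLinear.Build _ _ _ _ _ dl.
pose D : {linear U -> R} := HB.pack d dM.
have key (e : R) : 0 < e -> \forall v \near 0, `|f (v + x) - f x - D v| <= e * `|v|.
  move=> e0; pose e' := e / (#|I|%:R + 1).
  have e'0 : 0 < e' by rewrite divr_gt0// ltr_wpDl.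
  have : \forall y \near x, forall i, `|'D_(b i) f x - 'D_(b i) f y| <= e'.
    by apply: filter_forall => i; move/cvgrPdist_le: (@cf (b i) x); apply.
  move=> /nbhs_ballP[r/= r0 br].
  near=> v.
  have [t /andP[t0 t1] E] := mean_value_dir x v.
  rewrite [v + x]addrC E.
  rewrite /D/=/d (derive_dir_sum x) derive_dir_sum -sumrB.
  apply: (@le_trans _ _ (\sum_(i in I) e' * `|v|)).
    apply: (le_trans (ler_norm_sum _ _ _)); apply: ler_sum => i _.
    rewrite -mulrBr normrM mulrC ler_pM//.
    rewrite distrC; apply: br; rewrite -ball_normE/= opprD addrA subrr add0r normrN normrZ.
    rewrite ger0_norm//; apply: le_lt_trans (_ : `|v| < r); first by rewrite ler_piMl.
    by near: v; exact: nbhs0_lt.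
  rewrite sumr_const -mulr_natl mulrA ler_wpM2r// /e' mulrCA ler_piMr ?(ltW e0)//.
  by rewrite ler_pdivrMr ?ltr_wpDl// mul1r lerDl.
have dc : continuous D.
  apply/linear_bounded_continuous/linear_boundedP.
  exists (\sum_i `|'D_(b i) f x|); split; first exact: num_real.
  move=> r /ltW rb v; rewrite /D/=/d derive_dir_sum.
  apply: (le_trans (ler_norm_sum _ _ _)).
  apply: le_trans (ler_wpM2r (normr_ge0 v) rb).
  rewrite mulr_suml; apply: ler_sum => i _.
  by rewrite normrM mulrC ler_wpM2l.
have E : f \o shift x = cst (f x) + D +o_ 0 id.
  apply/eqaddoP => e e0; near=> v; rewrite /= !fctE opprD addrA.
  by near: v; exact: key.
have DE := diff_unique dc E.
by apply/diff_locallyP; rewrite DE.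
Unshelve. all: by end_near. Qed.
End continuously_differentiable.

Lemma coord_norm_le (R : realType) m (x : 'rV[R]_m) i : `|x 0 i| <= `|x|.
Proof.
rewrite [leRHS]/Num.Def.normr/= mx_normrE.
exact: (le_bigmax _ (fun ij : 'I_1 * 'I_m => `|x ij.1 ij.2|) (0, i)).
Qed.

Lemma row_norm_le (R : realType) m (x : 'rV[R]_m) M : 0 <= M ->
  (forall i, `|x 0 i| <= M) -> `|x| <= M.
Proof.
move=> M0 xM; rewrite [leLHS]/Num.Def.normr/= mx_normrE.
by apply: bigmax_le => // -[i j] _ /=; rewrite ord1.
Qed.

Section continuously_differentiable_row.
Variables (R : realType) (U : normedModType R).

Lemma C1_differentiable m (I : finType) (b : I -> U) (c : I -> U -> R)
    (f : U -> 'rV[R]_m) :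
  (forall v, v = \sum_i c i v *: b i) -> (forall i v, `|c i v| <= `|v|) ->
  Ck_on 1 [set: U] f -> forall x, differentiable f x.
Proof.
move=> bc ble [_ Cf] x.
have df v y : derivable f y v by have [H _] := Cf v; exact: H.
have fE : f = \sum_j (fun y => f y 0 j *: (delta_mx 0 j : 'rV[R]_m)).
  by apply/funext => y; rewrite fct_sumE; exact: row_sum_delta.
(* differentiability is reduced to the scalar coordinates of f *)
rewrite fE; apply: differentiable_sum => j; apply: differentiableZl.
apply: (C1_differentiable_scalar _ _ bc ble) => [v y|v].
  exact: (derivable_mxP _ _ _).1.
have -> : (fun y => 'D_v (fun z => f z 0 j) y) = (fun M : 'rV[R]_m => M 0 j) \o (fun y => 'D_v f y).
  by apply/funext => y /=; rewrite derive_mx// mxE.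
move=> y; apply: continuous_comp; last exact: coord_continuous.
by have [_ [H _]] := Cf v; exact: H.
Qed.

End continuously_differentiable_row.

Section pair.
Variable (R : realType).

Definition pair_base m (i : 'I_m + 'I_m) : 'rV[R]_m * 'rV[R]_m :=
  match i with inl j => (delta_mx 0 j, 0) | inr j => (0, delta_mx 0 j) end.

Definition pair_coord m (i : 'I_m + 'I_m) (p : 'rV[R]_m * 'rV[R]_m) : R :=
  match i with inl j => p.1 0 j | inr j => p.2 0 j end.

Lemma pair_coordK m (p : 'rV[R]_m * 'rV[R]_m) :
  p = \sum_i pair_coord i p *: pair_base i.
Proof.
rewrite big_sumType/=.
have E (T T' : lmodType R) n (F : 'I_n -> T * T') : \sum_i F i = (\sum_i (F i).1, \sum_i (F i).2).
  by elim/big_rec3 : _ => // i a b y _ ->.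
rewrite !E/= [LHS]surjective_pairing; congr pair.
  rewrite [X in _ + X]big1 ?addr0 => [|i _]; last by rewrite scaler0.
  exact: row_sum_delta.
rewrite [X in X + _]big1 ?add0r => [|i _]; last by rewrite scaler0.
exact: row_sum_delta.
Qed.

Lemma C1_differentiable_pair m k (f : 'rV[R]_m * 'rV[R]_m -> 'rV[R]_k) :
  Ck_on 1 setT f -> forall p, differentiable f p.
Proof.
move=> Cf; apply: (C1_differentiable _ _ Cf).
  exact: pair_coordK.
move=> i v; have -> : `|v| = Num.max `|v.1| `|v.2| by [].
by case: i => i; rewrite le_max coord_norm_le ?orbT.
Qed.

End pair.

(** * Derivatives along curves *)
Section curve.
Variables (R : realType) (U : normedModType R).

Lemma is_derive_comp_curve (W : normedModType R) (f : U -> W) (c : R -> U) t dc :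
  differentiable f (c t) -> is_derive t (1 : R) c dc ->
  is_derive t (1 : R) (fun s => f (c s)) ('d f (c t) dc).
Proof.
move=> df [cd <-].
have dc1 := (derivable1_diffP _ _).1 cd.
have d2 : differentiable (f \o c) t by exact: differentiable_comp.
split; first exact/derivable1_diffP.
by rewrite -/(f \o c) deriveE// diff_comp//= deriveE.
Qed.

Lemma is_derive_linear_curve (W : normedModType R) (f : {linear U -> W}) (c : R -> U) t dc :
  continuous f -> is_derive t (1 : R) c dc ->
  is_derive t (1 : R) (fun s => f (c s)) (f dc).
Proof.
move=> cf Hc; have := is_derive_comp_curve (linear_differentiable (c t) cf) Hc.
by move/is_derive_eq; apply; rewrite (diff_lin (c t) cf).
Qed.

Lemma is_derive_pair_curve (V W : normedModType R) (a : R -> V) (b : R -> W) (t : R) da db :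
  is_derive t (1 : R) a da -> is_derive t (1:R) b db ->
  is_derive t (1 : R) (fun s => (a s, b s)) (da, db).
Proof.
move=> [ad <-] [bd <-].
have a1 := (derivable1_diffP _ _).1 ad.
have b1 := (derivable1_diffP _ _).1 bd.
have d2 : differentiable (fun s => (a s, b s)) t by exact: differentiable_pair.
split; first exact/derivable1_diffP.
by rewrite deriveE// diff_pair//= !deriveE.
Qed.

Lemma is_derive_unique (V W : normedModType R) (f : V -> W) x v l l' :
  is_derive x v f l -> is_derive x v f l' -> l = l'.
Proof. by move=> [_ <-] [_ <-]. Qed.

Lemma is_derive_0_cst_row m (f : R -> 'rV[R]_m) :
  (forall t, is_derive t (1:R) f 0) -> forall s t, f s = f t.
Proof.
move=> H s t; apply/rowP => j.
apply: (@is_derive_0_is_cst R (fun s => f s 0 j)) => u.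
have [d1 d2] := H u.
split; first exact: (derivable_mxP _ _ _).1.
by move: d2; rewrite derive_mx// => /rowP/(_ j); rewrite !mxE.
Qed.

End curve.

Lemma is_derive_scale (R : realType) m (k : R -> R) (f : R -> 'rV[R]_m) (t dk : R) df :
  is_derive t (1 : R) k dk -> is_derive t (1 : R) f df ->
  is_derive t (1 : R) (fun s => k s *: f s) (dk *: f t + k t *: df).
Proof.
move=> dK [fd fE].
have H j : is_derive t (1 : R) (fun s => (k s *: f s) 0 j) (dk * f t 0 j + k t * df 0 j).
  have -> : (fun s => (k s *: f s) 0 j) = (fun s => k s * f s 0 j).
    by apply/funext => s; rewrite mxE.
  have dfj : is_derive t (1 : R) (fun s => f s 0 j) (df 0 j).
    split; first exact: (derivable_mxP _ _ _).1.
    by rewrite -fE derive_mx// mxE.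
  by apply: (is_derive_eq (is_deriveM dK dfj)); rewrite /GRing.scale/= addrC mulrC.
have D : derivable (fun s => k s *: f s) t (1:R).
  by apply/derivable_mxP => i j; rewrite ord1; have [] := H j.
split => //; rewrite derive_mx//; apply/rowP => j; rewrite !mxE.
by have [_ ->] := H j.
Qed.

(** * Lie groups in exponential coordinates *)
Section lie.
Variables (R : realType) (m : nat).
Local Notation V := 'rV[R]_m.
Variables (mul : V -> V -> V) (inv : V -> V).
Hypothesis (hG : is_lie_group mul inv 0) (hE : is_exponential_map mul id).

Let mu (p : V * V) := mul p.1 p.2.

Lemma exp_add s t u : mul (s *: u) (t *: u) = (s + t) *: u.
Proof. by have [/(_ s t)] := hE u. Qed.

Lemma exp_mulNx x : mul (- x) x = 0.
Proof. by have := exp_add (-1) 1 x; rewrite scaleN1r scale1r addNr scale0r. Qed.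

Lemma exp_mulxN x : mul x (- x) = 0.
Proof. by rewrite -{1}[x]opprK exp_mulNx. Qed.

Lemma exp_mul0x x : mul 0 x = x. Proof. exact: lie_mul1 hG x. Qed.

Lemma exp_mulx0 x : mul x 0 = x.
Proof. by rewrite -(exp_mulNx x) (lie_mulA hG) exp_mulxN exp_mul0x. Qed.

Lemma exp_mulA x y z : mul x (mul y z) = mul (mul x y) z.
Proof. exact: lie_mulA hG x y z. Qed.

Lemma exp_inv x : inv x = - x.
Proof.
by rewrite -[LHS]exp_mulx0 -(exp_mulxN x) exp_mulA (lie_mulV hG) exp_mul0x.
Qed.

(** Inversion is negation, because the one-parameter subgroups are the lines
    through 0. *)
Lemma exp_oppM x y : - mul x y = mul (- y) (- x).
Proof.
have E : mul (mul x y) (mul (- y) (- x)) = 0.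
  by rewrite exp_mulA -(exp_mulA x) exp_mulxN exp_mulx0 exp_mulxN.
by rewrite -[LHS]exp_mulx0 -E exp_mulA exp_mulNx exp_mul0x.
Qed.

Lemma mul_differentiable p : differentiable mu p.
Proof. by apply: (@C1_differentiable_pair _ _ _ mu); exact: (lie_mul_smooth hG 1%N). Qed.

Lemma derive_mul_differentiable w p : differentiable (fun q => 'D_w mu q) p.
Proof.
apply: (@C1_differentiable_pair _ _ _ (fun q => 'D_w mu q)).
by have [_ /(_ w) []] := lie_mul_smooth hG 2%N.
Qed.

Lemma is_derive_mul (a b : R -> V) t da db :
  is_derive t (1 : R) a da -> is_derive t (1 : R) b db ->
  is_derive t (1 : R) (fun s => mul (a s) (b s)) ('d mu (a t, b t) (da, db)).
Proof.
move=> Ha Hb.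
exact: (is_derive_comp_curve (mul_differentiable (a t, b t)) (is_derive_pair_curve Ha Hb)).
Qed.

Lemma is_derive_ray (x v : V) t : is_derive t (1 : R) (fun s => x + s *: v) v.
Proof.
have -> : (fun s => x + s *: v) = (fun s : R => cst x s + id s *: cst v s) by [].
apply: (is_derive_eq (is_deriveD (is_derive_cst x t (1 : R))
  (is_derive_scale (is_derive_id t (1:R)) (is_derive_cst v t (1:R))))).
by rewrite scaler0 addr0 scale1r add0r.
Qed.

Lemma is_derive_ray0 (v : V) t : is_derive t (1 : R) (fun s => s *: v) v.
Proof.
have := is_derive_ray 0 v t.
by have -> : (fun s => 0 + s *: v) = (fun s => s *: v) by apply/funext => s; rewrite add0r.
Qed.

(** The differential at the identity of left translation by x; as a function of
    x it is the left-invariant vector field with value v at the identity. *)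
Definition trans_diff (x v : V) : V := 'd mu (x, 0) (0, v).
Local Notation L := trans_diff.

Lemma trans_diffD x u v : L x (u + v) = L x u + L x v.
Proof. by rewrite /trans_diff -linearD/=; congr ('d mu _ (_, _)); rewrite addr0. Qed.

Lemma trans_diffZ x k v : L x (k *: v) = k *: L x v.
Proof. by rewrite /trans_diff -linearZ/=; congr ('d mu _ (_, _)); rewrite scaler0. Qed.

Lemma trans_diffN x v : L x (- v) = - L x v.
Proof. by rewrite -[in LHS]scaleN1r trans_diffZ scaleN1r. Qed.

Lemma is_derive_mulr x (b : R -> V) t db : b t = 0 -> is_derive t (1:R) b db ->
  is_derive t (1 : R) (fun s => mul x (b s)) (L x db).
Proof. by move=> b0 Hb; have := is_derive_mul (is_derive_cst x t (1:R)) Hb; rewrite b0. Qed.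

Lemma diff_mul_x0 x a : 'd mu (x, 0) (a, 0) = a.
Proof.
have := is_derive_mul (is_derive_ray x a 0) (is_derive_cst (0:V) 0 (1 : R)).
rewrite scale0r addr0 => H.
apply: is_derive_unique H _.
have -> : (fun s : R => mul (x + s *: a) (cst 0 s)) = (fun s => x + s *: a).
  by apply/funext => s; rewrite exp_mulx0.
exact: is_derive_ray.
Qed.

Lemma diff_mul_0y y b : 'd mu (0, y) (0, b) = b.
Proof.
have := is_derive_mul (is_derive_cst (0:V) 0 (1 : R)) (is_derive_ray y b 0).
rewrite scale0r addr0 => H.
apply: is_derive_unique H _.
have -> : (fun s : R => mul (cst 0 s) (y + s *: b)) = (fun s => y + s *: b).
  by apply/funext => s; rewrite exp_mul0x.
exact: is_derive_ray.
Qed.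

(** The differential of a right translation at the identity is that of the left
    translation by the opposite element: negation exchanges the two. *)
Lemma diff_mul_0y_left y a : 'd mu (0, y) (a, 0) = L (- y) a.
Proof.
have := is_derive_mul (is_derive_ray0 a 0) (is_derive_cst y 0 (1 : R)).
rewrite scale0r => H; apply: is_derive_unique H _.
have -> : (fun s : R => mul (s *: a) (cst y s)) = (fun s => - mul (- y) (s *: - a)).
  by apply/funext => s; rewrite exp_oppM opprK scalerN opprK.
rewrite -[X in is_derive _ _ _ X]opprK; apply: is_deriveN.
rewrite -trans_diffN.
by apply: is_derive_mulr; [rewrite scale0r|exact: is_derive_ray0].
Qed.

Lemma trans_diff0 v : L 0 v = v.
Proof. exact: diff_mul_0y. Qed.

(** A one-parameter subgroup t |-> t u is an integral curve of the left-invariant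
    field of u. *)
Lemma trans_diff_ray t u : L (t *: u) u = u.
Proof.
have H : is_derive (0:R) (1:R) (fun s : R => mul (t *: u) (s *: u)) (L (t *: u) u).
  by apply: is_derive_mulr; [rewrite scale0r|exact: is_derive_ray0].
apply: is_derive_unique H _.
have -> : (fun s : R => mul (t *: u) (s *: u)) = (fun s => t *: u + s *: u).
  by apply/funext => s; rewrite exp_add scalerDl.
exact: is_derive_ray.
Qed.

(** The left logarithmic derivative at x in the direction w: the inverse of
    [trans_diff x]. *)
Definition itrans_diff (x w : V) : V := 'd mu (- x, x) (0, w).
Local Notation om := itrans_diff.

Lemma trans_diffK x v : om x (L x v) = v.
Proof.
have H : is_derive (0:R) (1:R) (fun s : R => mul x (s *: v)) (L x v).
  by apply: is_derive_mulr; [rewrite scale0r|exact: is_derive_ray0].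
have := is_derive_mul (is_derive_cst (- x) 0 (1 : R)) H.
rewrite scale0r exp_mulx0 => H1; apply: is_derive_unique H1 _.
have -> : (fun s : R => mul (cst (- x) s) (mul x (s *: v))) = (fun s => s *: v).
  by apply/funext => s; rewrite exp_mulA exp_mulNx exp_mul0x.
exact: is_derive_ray0.
Qed.

Lemma itrans_diffK x w : L x (om x w) = w.
Proof.
have := is_derive_mul (is_derive_cst (- x) 0 (1 : R)) (is_derive_ray x w 0).
rewrite scale0r addr0 => H.
have H1 : is_derive (0:R) (1:R) (fun s : R => mul x (mul (cst (- x) s) (x + s *: w))) (L x (om x w)).
  by apply: (is_derive_mulr x _ H); rewrite scale0r addr0 exp_mulNx.
apply: is_derive_unique H1 _.
have -> : (fun s : R => mul x (mul (cst (- x) s) (x + s *: w))) = (fun s => x + s *: w).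
  by apply/funext => s; rewrite exp_mulA exp_mulxN exp_mul0x.
exact: is_derive_ray.
Qed.

Lemma left_invariant_fieldE u x : left_invariant_field mul 0 u x = L x u.
Proof.
rewrite /left_invariant_field; apply: derive_val; apply: is_derive_lineP.
apply: is_derive_mulr; first by rewrite scale0r addr0.
exact: is_derive_ray.
Qed.

Lemma trans_diff_differentiable v x : differentiable (fun y => L y v) x.
Proof.
have -> : (fun y => L y v) = (fun q => 'D_(0, v) mu q) \o (fun y => (y, 0)).
  by apply/funext => y; rewrite /= deriveE//; exact: mul_differentiable.
apply: differentiable_comp; last exact: derive_mul_differentiable.
exact: differentiable_pair.
Qed.

(** The second-order part of the group law at the identity: the coefficient of
    u and v in the expansion of the product. *)
Definition mixed_diff (u v : V) : V := 'd (fun x => L x v) (0 : V) u.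
Local Notation B := mixed_diff.

Lemma is_derive_trans_diff u v : is_derive (0:R) (1:R) (fun h => L (h *: u) v) (B u v).
Proof.
have := is_derive_comp_curve (c := fun h : R => h *: u) (t := 0)
  (trans_diff_differentiable v _) (is_derive_ray0 u 0).
by rewrite scale0r.
Qed.

Lemma mixed_diffDr u v w : B u (v + w) = B u v + B u w.
Proof.
apply: is_derive_unique (is_derive_trans_diff u (v + w)) _.
have -> : (fun h : R => L (h *: u) (v + w)) = (fun h => L (h *: u) v) + (fun h => L (h *: u) w).
  by apply/funext => h; rewrite trans_diffD.
by apply: is_deriveD; exact: is_derive_trans_diff.
Qed.

(** Along a line through 0 the field of its direction is constant, so the
    second-order part of the group law is alternating; it is therefore half of
    the Lie bracket. *)
Lemma mixed_diffuu u : B u u = 0.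
Proof.
apply: is_derive_unique (is_derive_trans_diff u u) _.
have -> : (fun h : R => L (h *: u) u) = cst u.
  by apply/funext => h; rewrite trans_diff_ray.
exact: is_derive_cst.
Qed.

Lemma mixed_diffDl u v w : B (u + v) w = B u w + B v w.
Proof. by rewrite /mixed_diff linearD. Qed.

Lemma mixed_diffC u v : B v u = - B u v.
Proof.
have := mixed_diffuu (u + v).
rewrite mixed_diffDr !mixed_diffDl !mixed_diffuu add0r addr0 => /eqP.
by rewrite addr_eq0 => /eqP.
Qed.

Local Notation br := (lie_bracket mul 0).

Lemma lie_bracketE u v : br u v = 2 *: B u v.
Proof.
have -> : br u v = B (L 0 u) v - B (L 0 v) u.
  rewrite /lie_bracket /field_bracket.
  have E w : left_invariant_field mul 0 w = (fun x => L x w).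
    by apply/funext => x; rewrite left_invariant_fieldE.
  rewrite !E !deriveE//; exact: trans_diff_differentiable.
by rewrite !trans_diff0 (mixed_diffC u v) opprK scaler_nat mulr2n.
Qed.

(** In this form the bracket with u is visibly linear and continuous. *)
Lemma lie_bracket_diff u : br u = -2 *: ('d (fun x => L x u) 0 : V -> V).
Proof.
by apply/funext => v; rewrite lie_bracketE mixed_diffC scalerN -scaleNr.
Qed.

Lemma is_derive_lie_bracket u (c : R -> V) t dc : is_derive t (1:R) c dc ->
  is_derive t (1:R) (fun s => br u (c s)) (br u dc).
Proof.
move=> Hc; rewrite lie_bracket_diff; apply: is_deriveZ.
exact: is_derive_linear_curve (diff_continuous (trans_diff_differentiable u 0)) Hc.
Qed.

End lie.

(** * The differential of the exponential map *)
Section equivariance.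
Variables (R : realType) (m : nat).
Local Notation V := 'rV[R]_m.
Variables (mul : V -> V -> V) (inv : V -> V).
Hypothesis (hG : is_lie_group mul inv 0) (hE : is_exponential_map mul id).

Let mu (p : V * V) := mul p.1 p.2.
Local Notation L := (trans_diff mul).
Local Notation om := (itrans_diff mul).
Local Notation B := (mixed_diff mul).
Local Notation br := (lie_bracket mul 0).

Lemma mixed_diff_sum (u v : V) : \sum_j v 0 j *: B u (delta_mx 0 j) = B u v.
Proof.
have BZ k w : B u (k *: w) = k *: B u w.
  apply: is_derive_unique (is_derive_trans_diff hG u (k *: w)) _.
  have -> : (fun h : R => L (h *: u) (k *: w)) = k *: (fun h => L (h *: u) w).
    by apply/funext => h; rewrite trans_diffZ.
  by apply: is_deriveZ; exact: (is_derive_trans_diff hG).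
have B0 : B u 0 = 0 by rewrite -[X in B u X](scale0r 0) BZ scale0r.
rewrite [in RHS](row_sum_delta v); apply/esym.
by elim/big_rec2 : _ => // j x y _ <-; rewrite (mixed_diffDr hG) BZ.
Qed.

Lemma trans_diff_sum (x v : V) : \sum_j v 0 j *: L x (delta_mx 0 j) = L x v.
Proof.
rewrite [in RHS](row_sum_delta v); apply/esym.
have L0 : L x 0 = 0 by rewrite -[X in L x X](scale0r 0) trans_diffZ scale0r.
by elim/big_rec2 : _ => // j y z _ <-; rewrite trans_diffD trans_diffZ.
Qed.

Lemma is_derive_trans_diff_curve u (c : R -> V) dc :
  is_derive (0:R) (1:R) c dc ->
  is_derive (0:R) (1:R) (fun h => L (h *: u) (c h)) (dc + B u (c 0)).
Proof.
move=> [cd cE].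
have -> : (fun h => L (h *: u) (c h)) =
    \sum_j (fun h => c h 0 j *: L (h *: u) (delta_mx 0 j)).
  by apply/funext => h; rewrite fct_sumE trans_diff_sum.
have -> : dc + B u (c 0) = \sum_j (dc 0 j *: L (0 *: u) (delta_mx 0 j) +
     c 0 0 j *: B u (delta_mx 0 j)).
  by rewrite big_split/= mixed_diff_sum trans_diff_sum scale0r (trans_diff0 hG).
apply: is_derive_sum => j.
apply: is_derive_scale; last exact: (is_derive_trans_diff hG).
split; first exact: (derivable_mxP _ _ _).1.
by rewrite -cE derive_mx// mxE.
Qed.

(** The derivative at s = 0 of the group element (- t u) (t (u + s w)): the
    differential at t u of the exponential map, in the direction t w, translated
    back to the identity. *)
Definition exp_diff u w (t : R) : V := 'd mu (- (t *: u), t *: u) (0, t *: w).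
Local Notation F := exp_diff.

Lemma exp_diffE u w t : F u w t = t *: om (t *: u) w.
Proof.
rewrite /exp_diff /itrans_diff -linearZ/=; congr ('d mu _ (_, _)).
by rewrite scaler0.
Qed.

(** Both sides are the derivative at s = 0 of one and the same group element,
    because (h u) (- (t + h) u) = - t u and
    (t + h) (u + s w) = (t (u + s w)) (h (u + s w)). *)
Lemma exp_diff_step u w t h :
  L (h *: u) (F u w (t + h)) = L (- (h *: u)) (F u w t) + h *: w.
Proof.
pose f t (s : R) := mul (- (t *: u)) (t *: u + s *: (t *: w)).
have df r : is_derive (0 : R) (1:R) (f r) (F u w r).
  have := is_derive_mul hG (is_derive_cst (- (r *: u)) 0 (1 : R)) (is_derive_ray (r *: u) (r *: w) 0).
  by rewrite scale0r addr0.
have f0 r : f r 0 = 0 by rewrite /f scale0r addr0 (exp_mulNx hE).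
have d1 := is_derive_mulr hG (h *: u) (f0 (t + h)) (df (t + h)).
apply: is_derive_unique d1 _.
have -> : (fun s => mul (h *: u) (f (t + h) s)) =
   (fun s => mul (f t s) (h *: u + s *: (h *: w))).
  apply/funext => s; rewrite /f (exp_mulA hG) -!scaleNr (exp_add hE).
  have E r : r *: u + s *: (r *: w) = r *: (u + s *: w).
    by rewrite scalerDr !scalerA mulrC.
  rewrite !E -(exp_mulA hG) (exp_add hE); congr (mul (_ *: _) _).
  by rewrite opprD addrCA subrr addr0.
have d2 := is_derive_mul hG (df t) (is_derive_ray (h *: u) (h *: w) 0).
rewrite scale0r addr0 f0 in d2.
apply: is_derive_eq d2 _.
rewrite -(diff_mul_0y_left hG hE) -[X in _ + X](diff_mul_0y hG (h *: u)).
by rewrite -linearD/=; congr ('d _ _ (_, _)); rewrite ?addr0 ?add0r.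
Qed.

Lemma exp_diff_derivable u w t : derivable (F u w) t (1 : R).
Proof.
have H : is_derive t (1:R) (fun s : R => (- (s *: u), s *: u)) (- u, u).
  apply: is_derive_pair_curve; last exact: is_derive_ray0.
  by apply: is_deriveN; exact: is_derive_ray0.
have H1 := is_derive_comp_curve (derive_mul_differentiable hG (0, w) (- (t *: u), t *: u)) H.
have -> : F u w = (fun s => id s *: 'D_(0, w) mu (- (s *: u), s *: u)).
  apply/funext => s; rewrite exp_diffE deriveE//; exact: (mul_differentiable hG).
by have [] := is_derive_scale (is_derive_id t (1 : R)) H1.
Qed.

(** The equation comes from differentiating [exp_diff_step] in h at 0. It involves
    the group law through the bracket only. *)
Lemma is_derive_exp_diff u w t : is_derive t (1 : R) (F u w) (w - br u (F u w t)).
Proof.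
have [D0 HD] : exists D, is_derive t (1:R) (F u w) D.
  by eexists; apply: derivableP; exact: exp_diff_derivable.
apply: is_derive_eq (HD) _.
have HD0 : is_derive (0:R) (1:R) (fun h => F u w (t + h)) D0.
  have [d1 d2] := HD.
  have e : (fun h : R => h^-1 *: (((fun s => F u w (t + s)) \o shift (0:R)) (h *: 1) -
     F u w (t + 0))) = (fun h => h^-1 *: ((F u w \o shift t) (h *: 1) - F u w t)).
    by apply/funext => h /=; rewrite !addr0 [t + _]addrC.
  by split; move: d1 d2; rewrite /derivable /derive e.
have H1 := is_derive_trans_diff_curve u HD0.
rewrite addr0 in H1.
have H2 : is_derive (0:R) (1:R) (fun h => L (h *: - u) (F u w t) + h *: w)
   (B (- u) (F u w t) + w).
  by apply: is_deriveD; [exact: (is_derive_trans_diff hG)|exact: is_derive_ray0].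
have E : (fun h => L (h *: u) (F u w (t + h))) =
   (fun h => L (h *: - u) (F u w t) + h *: w).
  by apply/funext => h; rewrite exp_diff_step scalerN.
rewrite E in H1.
have BN x y : B (- x) y = - B x y by rewrite /mixed_diff linearN.
have E1 := is_derive_unique H1 H2; rewrite BN in E1.
have -> : D0 = w - B u (F u w t) - B u (F u w t).
  by rewrite -[LHS](addrK (B u (F u w t))) E1 [- _ + w]addrC.
by rewrite (lie_bracketE hG hE) scaler_nat mulr2n opprD addrA.
Qed.

End equivariance.

(** * Lie algebra morphisms are group morphisms *)
Lemma foldr_nseq (T S : Type) (f : T -> S -> S) x n u :
  foldr f x (nseq n u) = iter n (f u) x.
Proof. by elim: n => //= n ->. Qed.

Section homomorphism.
Variables (R : realType) (m : nat).
Local Notation V := 'rV[R]_m.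
Variables (mul : V -> V -> V) (inv : V -> V).
Hypothesis (hG : is_lie_group mul inv 0) (hE : is_exponential_map mul id).
Hypothesis hN : nilpotent_lie_algebra (lie_bracket mul 0).
Variable phi : {linear V -> V}.
Hypothesis cphi : continuous phi.
Hypothesis phibr : forall u v, phi (lie_bracket mul 0 u v) = lie_bracket mul 0 (phi u) (phi v).

Local Notation L := (trans_diff mul).
Local Notation om := (itrans_diff mul).
Local Notation br := (lie_bracket mul 0).

(** Uniqueness for D' = - [u, D] is elementary by nilpotency: the iterated brackets
    ad_u^k D vanish for large k, and ad_u^(k+1) D = 0 says that ad_u^k D is
    constant, hence equal to its value 0 at time 0. *)
Lemma nilpotent_ode u (D : R -> V) :
  (forall t, is_derive t (1 : R) D (- br u (D t))) -> D 0 = 0 -> forall t, D t = 0.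
Proof.
move=> HD D0.
have [s hs] := hN.
have br0 : br u 0 = 0 by rewrite (lie_bracket_diff hG hE)/= !fctE linear0 scaler0.
have brN v : br u (- v) = - br u v by rewrite (lie_bracket_diff hG hE)/= !fctE linearN scalerN.
have Hj j t : is_derive t (1 : R) (fun t => iter j (br u) (D t)) (- iter j.+1 (br u) (D t)).
  elim: j => [|j IH]; first exact: HD.
  apply: is_derive_eq (is_derive_lie_bracket hG hE u IH) _.
  by rewrite brN.
(* Hj is the equation for the iterated brackets; descend from order s to order 0 *)
suff H k t : iter (s - k) (br u) (D t) = 0 by move=> t; have := H s t; rewrite subnn.
elim: k t => [|k IH] t.
  rewrite subn0.
  have := hs (nseq_tuple s u) (D t).
  by rewrite foldr_nseq.
have [sk|ks] := leqP s k.
  have e1 : (s - k = 0)%N by apply/eqP.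
  have e2 : (s - k.+1 = 0)%N by apply/eqP; rewrite subn_eq0 ltnW.
  by have := IH t; rewrite e1 e2.
have E : (s - k = (s - k.+1).+1)%N by rewrite subnSK.
have H0 r : is_derive r (1 : R) (fun t => iter (s - k.+1) (br u) (D t)) 0.
  by apply: is_derive_eq (Hj _ r) _; rewrite -E IH oppr0.
transitivity (iter (s - k.+1) (br u) (D 0)); first exact: (is_derive_0_cst_row H0).
rewrite D0.
by elim: (s - k.+1)%N => [|j IHj]; rewrite ?iterS ?IHj ?br0.
Qed.

Lemma lie_bracketBr u v w : br u (v - w) = br u v - br u w.
Proof. by rewrite (lie_bracket_diff hG hE)/= !fctE linearB scalerBr. Qed.

Let phiB u w x : phi (w - br u x) = phi w - br (phi u) (phi x).
Proof. by rewrite (linearB phi) phibr. Qed.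

(** The difference of the two sides solves the equation of [nilpotent_ode]. *)
Lemma exp_diff_equivariant u w t :
  phi (exp_diff mul u w t) = exp_diff mul (phi u) (phi w) t.
Proof.
apply/eqP; rewrite -subr_eq0; apply/eqP.
pose D s := phi (exp_diff mul u w s) - exp_diff mul (phi u) (phi w) s.
apply: (@nilpotent_ode (phi u) D) => [{}t|]; last first.
  by rewrite /D !exp_diffE !scale0r linear0 subr0.
have d1 := is_derive_linear_curve cphi (is_derive_exp_diff hG hE u w t).
have d2 := is_derive_exp_diff hG hE (phi u) (phi w) t.
apply: is_derive_eq (is_deriveB d1 d2) _.
rewrite phiB /D lie_bracketBr.
move: (phi w) (br _ _) (br _ _) => a b c.
by rewrite !opprB addrC addrA subrK.
Qed.

Lemma trans_diff_equivariant u w : phi (L u w) = L (phi u) (phi w).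
Proof.
have H := exp_diff_equivariant u (L u w) 1.
rewrite !exp_diffE !scale1r (trans_diffK hG hE) in H.
by rewrite H (itrans_diffK hG hE).
Qed.

Lemma diff_mul_x0D x a b :
  'd (fun p : V * V => mul p.1 p.2) (x, 0) (a, b) = a + L x b.
Proof.
have -> : (a, b) = (a, 0) + (0, b) :> V * V.
  by congr pair; rewrite ?addr0 ?add0r.
by rewrite linearD/= (diff_mul_x0 hG hE).
Qed.

Lemma diff_mul00 p : 'd (fun p : V * V => mul p.1 p.2) p (0, 0) = 0.
Proof. exact: linear0. Qed.

(** A bracket-preserving linear map phi preserves left-invariant fields, so
    t |-> phi (x (t y)) has velocity the field of phi y, and multiplying it on the
    right by - t phi y gives a curve with zero derivative. Comparing times 0 and 1
    gives the claim. *)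
Lemma exp_linear_mul x y : phi (mul x y) = mul (phi x) (phi y).
Proof.
pose c t := phi (mul x (t *: y)).
have dc t : is_derive t (1 : R) c (L (c t) (phi y)).
  rewrite /c -trans_diff_equivariant; apply: is_derive_linear_curve => //.
  have -> : (fun s : R => mul x (s *: y)) =
      (fun s => mul (mul x (t *: y)) (- (t *: y) + s *: y)).
    apply/funext => s.
    by rewrite -(exp_mulA hG) -scaleNr -scalerDl (exp_add hE) addrA subrr add0r.
  apply: (is_derive_mulr hG); first by rewrite addNr.
  exact: is_derive_ray.
pose h t := mul (c t) (- (t *: phi y)).
have dh t : is_derive t (1 : R) h 0.
  have -> : h = fun s => mul (mul (c s) (t *: phi y + s *: - phi y)) (- (t *: phi y)).
    apply/funext => s; rewrite /h -(exp_mulA hG) scalerN -!scaleNr -scalerDl (exp_add hE).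
    by rewrite addrAC subrr add0r.
  have b0 : t *: phi y + t *: - phi y = 0 by rewrite scalerN subrr.
  have d1 := is_derive_mul hG (dc t) (is_derive_ray (t *: phi y) (- phi y) t).
  rewrite b0 diff_mul_x0D trans_diffN subrr in d1.
  have d2 := is_derive_mul hG d1 (is_derive_cst (- (t *: phi y)) t (1 : R)).
  rewrite diff_mul00 in d2.
  exact: d2.
have h01 := is_derive_0_cst_row dh 1 0.
rewrite /h /c !scale0r oppr0 !(exp_mulx0 hG hE) !scale1r in h01.
by rewrite -h01 -(exp_mulA hG) (exp_mulNx hE) (exp_mulx0 hG hE).
Qed.

End homomorphism.

(** * Dilations *)
Section dilation.
Variables (R : realType) (m : nat) (a : 'I_m -> R).
Local Notation V := 'rV[R]_m.

Lemma dilation_is_linear r : linear (dilation a r : V -> V).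
Proof.
by move=> k u v; apply/rowP => i; rewrite !mxE; ring.
Qed.

HB.instance Definition _ r :=
  GRing.isLinear.Build R V V _ (dilation a r : V -> V) (dilation_is_linear r).

Lemma dilation_continuous r : continuous (dilation a r : V -> V).
Proof.
apply/linear_bounded_continuous/linear_boundedP.
exists (\sum_i r `^ a i); split; first exact: num_real.
move=> M /ltW rM v.
have sM : 0 <= \sum_i r `^ a i by apply: sumr_ge0 => i _; exact: powR_ge0.
have M0 : 0 <= M by exact: le_trans rM.
apply: row_norm_le => [|i]; first by rewrite mulr_ge0.
rewrite mxE normrM ler_pM//; last exact: coord_norm_le.
rewrite ger0_norm ?powR_ge0//; apply: le_trans rM.
by rewrite (bigD1 i)//= lerDl sumr_ge0// => j _; exact: powR_ge0.
Qed.

Lemma dilation_delta r j : dilation a r (delta_mx 0 j : V) = r `^ a j *: (delta_mx 0 j : V).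
Proof.
apply/rowP => i; rewrite !mxE eqxx/=.
by have [->|] := eqVneq i j; rewrite ?mulr0.
Qed.

Lemma dilation_cvg0 x : (forall i, 1 <= a i) -> dilation a r x @[r --> 0^'+] --> (0 : V).
Proof.
move=> a1; apply/cvgrPdist_le => /= e e0.
have d0 : 0 < e / (`|x| + 1) by rewrite divr_gt0// ltr_wpDl.
near=> r.
have r0 : 0 < r by [].
have r1 : r <= 1 by near: r; exact: nbhs_right_le.
rewrite sub0r normrN; apply: (@le_trans _ _ (r * (`|x| + 1))); last first.
  by rewrite -ler_pdivlMr ?ltr_wpDl//; near: r; exact: nbhs_right_le.
apply: row_norm_le => [|i]; first by rewrite mulr_ge0 ?(ltW r0)// addr_ge0.
rewrite mxE normrM ler_pM//.
  by rewrite ger0_norm ?powR_ge0// ge1r_powR// r0 r1.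
by rewrite (le_trans (coord_norm_le _ _))// lerDl.
Unshelve. all: by end_near. Qed.

End dilation.

(** * The triangular form of the group law *)
Section homogeneous.
Variables (R : realType) (n : nat) (G : homogeneous_group R n).
Local Notation V := 'rV[R]_n.+1.
Local Notation mul := (hg_mul G).
Local Notation wt := (hg_weight G).
Local Notation delta := (dilation wt).
Let mu (p : V * V) := mul p.1 p.2.

Lemma hg_weight_ge1 i : 1 <= wt i.
Proof. by rewrite -(hg_weight0 G); exact: hg_weight_le. Qed.

Lemma dilation_mul r x y : 0 < r -> delta r (mul x y) = mul (delta r x) (delta r y).
Proof.
move=> r0.
apply: (exp_linear_mul (hg_lie_group G) (hg_exp G) (hg_nilpotent G)
  (phi := delta r)); first exact: dilation_continuous.
by move=> u v; exact: hg_dilation.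
Qed.

Let diff_mulZ p k q : 'd mu p (k *: q) = k *: 'd mu p q.
Proof. exact: linearZZ. Qed.

Let diff_mul_sum p (v : V) :
  'd mu p (0, v) = \sum_j v 0 j *: 'd mu p (0, delta_mx 0 j).
Proof.
have -> : (0, v) = \sum_j v 0 j *: (0, delta_mx 0 j) :> V * V.
  rewrite [in LHS](row_sum_delta v).
  elim/big_rec2 : _ => // j x y _ <-.
  by rewrite -[LHS]/(0, _) -[RHS]/(_ + _, _ + _); congr pair; rewrite /= scaler0 addr0.
by rewrite linear_sum; apply: eq_bigr => j _; exact: diff_mulZ.
Qed.

Definition mul_partial (i j : 'I_n.+1) (p : V * V) : R := ('D_(0, delta_mx 0 j) mu p) 0 i.

Lemma mul_partialE i j p : mul_partial i j p = ('d mu p (0, delta_mx 0 j)) 0 i.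
Proof. by rewrite /mul_partial deriveE//; exact: (mul_differentiable (hg_lie_group G)). Qed.

Lemma mul_partial_continuous i j : continuous (mul_partial i j).
Proof.
move=> p; apply: (@continuous_comp _ _ _ (fun q => 'D_(0, delta_mx 0 j) mu q) (fun M : V => M 0 i)).
  exact/differentiable_continuous/(derive_mul_differentiable (hg_lie_group G)).
exact: coord_continuous.
Qed.

(** Homogeneity of the i-th coordinate of the product, of degree [wt i],
    differentiated in the j-th coordinate of the second factor. *)
Lemma mul_partial_dilation r i j x y : 0 < r ->
  r `^ wt j * mul_partial i j (delta r x, delta r y) = r `^ wt i * mul_partial i j (x, y).
Proof.
move=> r0; rewrite !mul_partialE.
set e := delta_mx 0 j.
have d1 := is_derive_mul (hg_lie_group G) (is_derive_cst x 0 (1 : R)) (is_derive_ray y e 0).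
have d2 := is_derive_linear_curve (f := delta r) (@dilation_continuous _ _ wt r) d1.
have d3 := is_derive_mul (hg_lie_group G) (is_derive_cst (delta r x) 0 (1 : R))
  (is_derive_ray (delta r y) (r `^ wt j *: e) 0).
rewrite !scale0r !addr0 in d2 d3.
have E : (fun s : R => delta r (mul (cst x s) (y + s *: e))) =
    (fun s => mul (cst (delta r x) s) (delta r y + s *: (r `^ wt j *: e))).
  apply/funext => s; rewrite dilation_mul//; congr mul.
  by rewrite linearD linearZ/= dilation_delta.
rewrite E in d2.
have E0 : (0, r `^ wt j *: e) = r `^ wt j *: (0, e) :> V * V.
  by congr pair; rewrite scaler0.
have E1 : 'd mu (delta r x, delta r y) (0, r `^ wt j *: e) =
    r `^ wt j *: 'd mu (delta r x, delta r y) (0, e) by rewrite E0; exact: diff_mulZ.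
have /rowP/(_ i) := etrans (esym E1) (is_derive_unique d3 d2).
by rewrite [in LHS]mxE [in RHS]mxE.
Qed.

(** By homogeneity the partial derivative at a point is the one at its dilate by r,
    times r to the power [wt j - wt i]. As r tends to 0 the dilate tends to the
    identity, where the partial derivatives are those of the sum. *)
Lemma mul_partial_triangular (i j : 'I_n.+1) p : (i <= j)%N -> mul_partial i j p = (i == j)%:R.
Proof.
move=> ij; case: p => x y.
have c00 : mul_partial i j (0, 0) = (i == j)%:R.
  by rewrite mul_partialE (diff_mul_0y (hg_lie_group G)) mxE.
have c1 : mul_partial i j (delta r x, delta r y) @[r --> 0^'+] --> ((i == j)%:R : R).
  rewrite -c00.
  have c0 : (delta r x, delta r y) @[r --> 0^'+] --> ((0 : V), (0 : V)).
    exact: (cvg_pair (dilation_cvg0 x hg_weight_ge1) (dilation_cvg0 y hg_weight_ge1)).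
  exact: (@cvg_comp R (V * V)%type R (fun r : R => (delta r x, delta r y))
    (mul_partial i j) (0:R)^'+ (nbhs ((0 : V), (0 : V))) _ c0 (@mul_partial_continuous i j (0, 0))).
(* for equal weights the power of r is 1; for distinct ones it tends to 0, and
   then i and j are distinct too *)
have c2 : r `^ (wt j - wt i) * mul_partial i j (delta r x, delta r y) @[r --> 0^'+] --> ((i == j)%:R : R).
  have [eqw|neqw] := eqVneq (wt j) (wt i).
    by under eq_fun do rewrite eqw subrr powRr0 mul1r.
  have -> : (i == j)%:R = 0 * (i == j)%:R :> R.
    by rewrite mul0r; have [ijE|//] := eqVneq i j; rewrite ijE eqxx in neqw.
  apply: cvgM c1; apply: powR_cvg0.
  by rewrite subr_gt0 lt_neqAle eq_sym neqw/=; exact: hg_weight_le.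
have qE : {near (0 : R)^'+, (fun r => r `^ (wt j - wt i) * mul_partial i j (delta r x, delta r y))
    =1 (fun=> mul_partial i j (x, y))}.
  near=> r.
  have r0 : 0 < r by [].
  have e : r `^ (wt j - wt i) = r `^ wt j / r `^ wt i 
    by rewrite powRB//; apply/implyP => _; rewrite gt_eqF.
  rewrite /= e mulrAC mul_partial_dilation//.
  by rewrite mulrC mulKf// gt_eqF// powR_gt0.
have c3 : (fun=> mul_partial i j (x, y)) @ (0 : R)^'+ --> ((i == j)%:R : R).
  exact: cvg_trans (near_eq_cvg qE) c2.
by have := cvg_lim _ c3; rewrite lim_cst//; exact.
Unshelve. all: by end_near. Qed.

(** The i-th coordinate of a product is the i-th coordinate of its second factor
    plus a function of the first factor and of the earlier coordinates of the
    second one. *)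
Lemma mul_triangular (x y y' : V) (i : 'I_n.+1) :
  (forall j : 'I_n.+1, (j < i)%N -> y 0 j = y' 0 j) ->
  (mul x y) 0 i - y 0 i = (mul x y') 0 i - y' 0 i.
Proof.
move=> yy'.
pose v := y' - y.
(* k is constant on the segment from y to y' *)
pose k (s : R) := (mul x (y + s *: v)) 0 i - s * v 0 i.
have dk s : is_derive s (1 : R) k 0.
  have [d1 d2] := is_derive_mul (hg_lie_group G) (is_derive_cst x s (1 : R)) (is_derive_ray y v s).
  have dm : is_derive s (1 : R) (fun s => (mul x (y + s *: v)) 0 i) (v 0 i).
    split; first exact: (derivable_mxP _ _ _).1.
    have /rowP/(_ i) := d2.
    rewrite derive_mx// mxE => ->.
    rewrite diff_mul_sum summxE (bigD1 i)//= mxE -mul_partialE.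
    rewrite mul_partial_triangular// eqxx mulr1 big1 ?addr0// => j ji.
    rewrite mxE -mul_partialE.
    have [ij|ji'] := leqP i j.
      by rewrite mul_partial_triangular// eq_sym (negbTE ji) mulr0.
    by rewrite /v !mxE yy'// subrr mul0r.
  have dv : is_derive s (1 : R) (fun s => s * v 0 i) (v 0 i).
    by apply: trigger_derive; rewrite /GRing.scale/= mulr0 mulr1 add0r.
  by apply: is_derive_eq (is_deriveB dm dv) _; rewrite subrr.
have := is_derive_0_is_cst 0 1 dk.
rewrite /k scale0r mul0r scale1r mul1r subr0 addr0 /v [y + _]addrC subrK !mxE => ->.
ring.
Qed.

End homogeneous.

(** * Borel sets and volumes of rows *)
Section borel.
Variables (R : realType) (m : nat).
Local Notation V := 'rV[R]_m.

(** Boxes with rational centre and radius 1 / (k + 1): a countable base of the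
    topology made of measurable sets. *)
Definition rat_box (p : 'rV[rat]_m * nat) : set V :=
  [set y | forall i, `|y 0 i - ratr (p.1 0 i)| < p.2.+1%:R^-1].

Lemma measurable_rat_box p : measurable (rat_box p).
Proof.
rewrite (_ : rat_box p = \bigcap_(i in [set: 'I_m])
    (fun x : V => x 0 i : measurableTypeR R) @^-1` (ball (ratr (p.1 0 i) : R) p.2.+1%:R^-1)).
  apply: fin_bigcap_measurable => // i _.
  rewrite -[X in measurable X]setTI; apply: measurable_coord => //.
  exact: measurable_ball.
apply/seteqP; split => x /= H.
  by move=> i _; have := H i; rewrite /ball/= distrC.
by move=> i; have := H i I; rewrite /ball/= distrC.
Qed.

Lemma open_measurable_row (U : set V) : open U -> measurable U.
Proof.
move=> oU.
rewrite (_ : U = \bigcup_p (if pselect (rat_box p `<=` U) then rat_box p else set0)).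
  apply: countable_bigcupT_measurable; first exact: countableP.
  by move=> p; case: pselect => ? //=; exact: measurable_rat_box.
rewrite eqEsubset; split; last by apply: bigcup_sub => p _; case: pselect => ? //=.
move=> x Ux.
have /nbhs_ballP[e /= e0 eU] := open_nbhs_nbhs (conj oU Ux).
have [k ke] : exists k : nat, k.+1%:R^-1 < e / 2.
  have /ltr_add_invr[k] : 0 < e / 2 by rewrite divr_gt0.
  by rewrite add0r; exists k.
have /choice[q Hq] : forall i : 'I_m, exists q : rat, `|x 0 i - ratr q| < k.+1%:R^-1.
  move=> i; have [|q] := @rat_in_itvoo R (x 0 i - k.+1%:R^-1) (x 0 i + k.+1%:R^-1).
    by rewrite ltrD2l gtrN.
  rewrite in_itv/= => /andP[q1 q2]; exists q.
  by rewrite ltr_distlC q1 q2.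
(* the box around a rational point near x contains x and has diameter less than e *)
exists (\row_i q i, k) => //.
case: pselect => [h i|[]]; first by rewrite /= mxE.
move=> y /= Hy; apply: eU; rewrite -ball_normE /=.
apply: (@le_lt_trans _ _ (k.+1%:R^-1 + k.+1%:R^-1)); last by rewrite [ltRHS]splitr ltrD.
apply: row_norm_le => [|i]; first by rewrite addr_ge0.
rewrite !mxE -(subrKA (ratr (q i))) (le_trans (ler_normD _ _))// lerD ?ltW//.
by have := Hy i; rewrite mxE distrC.
Qed.

Lemma continuous_measurable_row (f : V -> R) : continuous f -> measurable_fun [set: V] f.
Proof.
move=> cf; apply: (@measurability _ _ V (measurableTypeR R) setT f _ (RGenOpens.measurableE R)) => _ [_ [a [b ->] <-]].
rewrite setTI; apply: open_measurable_row.
by move/continuousP : cf; apply; exact: interval_open.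
Qed.
End borel.

Section volume.
Variable R : realType.
Local Open Scope ereal_scope.

(** A set whose i-th coordinate oscillates by at most [d i] once the earlier
    coordinates are fixed has at most the volume of a box of sides [2 * d i]: slice
    along the first coordinate. The hypothesis is stable under triangular changes of variables,
    and so replaces their invariance of volume; the factor 2 comes from centring
    each interval at an arbitrary point of the set. *)
Lemma lebesgue_row_le n (A : set 'rV[R]_n) (d : 'I_n -> R) :
  measurable A -> (forall i, 0 <= d i)%R ->
  (forall y y', A y -> A y' -> forall i : 'I_n,
    (forall j : 'I_n, (j < i)%N -> y 0%R j = y' 0%R j) -> (`|y 0%R i - y' 0%R i| <= d i)%R) ->
  lebesgue_row R n A <= (\prod_i (2 * d i))%R%:E.
Proof.
elim: n A d => [|n IH] A d mA d0 HA.
  by rewrite big_ord0 /= diracE lee_fin; case: (_ \in _).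
have [->|/set0P[y0 Ay0]] := eqVneq A set0.
  by rewrite measure0 lee_fin prodr_ge0// => i _; rewrite mulr_ge0.
rewrite big_ord_recl /=.
set P := (\prod_(i < n) _)%R.
have P0 : (0 <= P)%R by apply: prodr_ge0 => i _; rewrite mulr_ge0.
pose B := @row_cons R n @^-1` A.
have mB : measurable B.
  by rewrite -[X in measurable X]setTI; exact: measurable_row_cons.
pose K : set (measurableTypeR R) := `[(y0 0%R ord0 - d ord0)%R, (y0 0%R ord0 + d ord0)%R]%classic.
have mK : measurable K by exact: measurable_itv.
have mI : measurable_fun setT (fun t => (\1_K t)%:E : \bar R).
  by apply/measurable_EFinP; exact: measurable_indic.
have -> : lebesgue_row_step (lebesgue_row R n) A =
   \int[@lebesgue_measure R]_t (lebesgue_row R n (xsection B t)) by [].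
apply: (@le_trans _ _ (\int[@lebesgue_measure R]_t (P%:E * (\1_K t)%:E))).
  apply: ge0_le_integral => //.
  - exact: measurable_fun_xsection.
  - exact: measurable_funeM.
  - move=> t _; have [tK|tK] := boolP (t \in K).
      rewrite indicE tK mule1; apply: IH => //; first exact: measurable_xsection.
      move=> y y' /xsectionP Ay /xsectionP Ay' i yy'.
      have := HA _ _ Ay Ay' (lift ord0 i); rewrite !row_consS; apply => j.
      case: (unliftP ord0 j) => [k ->|->]; last by rewrite !row_cons0.
      by rewrite !row_consS lift0 ltnS; exact: yy'.
    rewrite indicE (negbTE tK) mule0.
    rewrite (_ : xsection B t = set0) ?measure0//.
    apply/seteqP; split => // y /xsectionP Ay.
    have := HA _ _ Ay Ay0 ord0; rewrite row_cons0/= => H.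
    case/negP: tK; rewrite inE /K/= in_itv/= -ler_distlC distrC; exact: H.
rewrite ge0_integralZl// integral_indic// setIT.
have KE : lebesgue_measure K <= (2 * d ord0)%R%:E.
  have -> := lebesgue_measure_itv `[(y0 0%R ord0 - d ord0)%R, (y0 0%R ord0 + d ord0)%R].
  rewrite /= lte_fin; case: ifPn => _; last by rewrite lee_fin mulr_ge0.
  by rewrite -EFinB lee_fin; lra.
by rewrite mulrC EFinM; apply: lee_wpmul2l; rewrite ?lee_fin.
Qed.

End volume.

(** * Homogeneous norms *)
Lemma prod_powR (R : realType) n (a : 'I_n.+1 -> R) (r : R) : 0 <= r ->
  (forall i, 1 <= a i) -> \prod_i r `^ a i = r `^ (\sum_i a i).
Proof.
move=> r0 a1.
have s0 : 0 < \sum_i a i.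
  apply: (@lt_le_trans _ _ (\sum_(i < n.+1) 1)); last by apply: ler_sum => i _.
  by rewrite sumr_const card_ord ltr0n.
have [->|rn0] := eqVneq r 0.
  rewrite powR0 ?gt_eqF// (bigD1 ord0)//= powR0 ?mul0r//.
  by rewrite gt_eqF// (lt_le_trans _ (a1 _)).
elim/big_rec2 : _ => [|i x y _ ->]; first by rewrite powRr0.
by rewrite powRD// rn0 implybT.
Qed.

Section norm.
Variables (R : realType) (n : nat) (G : homogeneous_group R n).
Local Notation V := 'rV[R]_n.+1.
Local Notation mul := (hg_mul G).
Local Notation wt := (hg_weight G).
Local Notation delta := (dilation wt).
Local Notation Q := (homogeneous_dim G).
Variable N : V -> R.
Hypothesis hN : is_homogeneous_norm G N.

Lemma homogeneous_dim_gt0 : 0 < Q.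
Proof.
apply: (@lt_le_trans _ _ (\sum_(i < n.+1) 1)); last first.
  by apply: ler_sum => i _; exact: hg_weight_ge1.
by rewrite sumr_const card_ord ltr0n.
Qed.

Lemma hg_invE y : hg_inv G y = - y.
Proof. exact: (exp_inv (hg_lie_group G) (hg_exp G)). Qed.

Lemma hnormN x : N (- x) = N x.
Proof. by rewrite -hg_invE (hnorm_inv hN). Qed.

Lemma hnorm0 : N 0 = 0.
Proof. by apply/(hnorm_eq0 hN). Qed.

Lemma hg_mul0x x : mul 0 x = x.
Proof. exact: (exp_mul0x (hg_lie_group G)). Qed.

Lemma hnorm_sphere_lb : exists2 m0, 0 < m0 & forall x, `|x| = 1 -> m0 <= N x.
Proof.
pose S := [set x : V | `|x| = 1].
have S0 : S !=set0.
  exists (const_mx 1); apply/eqP; rewrite eq_le; apply/andP; split.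
    by apply: row_norm_le => // i; rewrite mxE normr1.
  by have := coord_norm_le (const_mx 1 : V) ord0; rewrite mxE normr1.
have cS : compact S.
  apply: bounded_closed_compact.
    by exists 1; split => // M M1 x /= ->; exact: ltW.
  have -> : S = (Num.norm : V -> R) @^-1` [set 1 : R] by [].
  by apply: preimage_closed; [move=> ? _; exact: norm_continuous|exact: closed_eq].
have [c cS1 Nc] := EVT_min_rV S0 cS (continuous_subspaceT (hnorm_continuous hN)).
exists (N c); last by move=> x x1; apply: Nc; rewrite inE.
rewrite lt_neqAle eq_sym (hnorm_ge0 hN) andbT; apply/negP => /eqP /(hnorm_eq0 hN) c0.
by move: cS1; rewrite inE /S/= c0 normr0 => /eqP; rewrite eq_sym oner_eq0.
Qed.

Variable m0 : R.
Hypothesis m0_gt0 : 0 < m0.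
Hypothesis m0_lb : forall x, `|x| = 1 -> m0 <= N x.

(** If some coordinate exceeded 1, shrinking x by the gauge
    t = max_j |x_j|^(1 / wt j) > 1 would bring it to the unit sphere with norm
    N x / t < m0. *)
Lemma hnorm_unit_box x i : N x <= m0 -> `|x 0 i| <= 1.
Proof.
move=> Nx; rewrite leNgt; apply/negP => xi.
have wt0 j : wt j != 0 by rewrite gt_eqF// (lt_le_trans _ (hg_weight_ge1 G j)).
have wtV0 j : 0 <= (wt j)^-1 by rewrite invr_ge0 (le_trans _ (hg_weight_ge1 G j)).
have one a : 1 = 1 `^ a :> R by rewrite powR1.
pose g j := `|x 0 j| `^ (wt j)^-1.
have gE j : g j `^ wt j = `|x 0 j| by rewrite /g -powRrM mulVf// powRr1.
pose k := [arg max_(j > i) g j]%O.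
have gk j : g j <= g k by rewrite /k; case: arg_maxP => // l _; exact.
have gi : 1 < g i.
  rewrite [ltLHS](one (wt i)^-1) /g; apply: gt0_ltr_powR; rewrite ?nnegrE//.
  by rewrite invr_gt0 (lt_le_trans _ (hg_weight_ge1 G i)).
have t1 : 1 < g k := lt_le_trans gi (gk i).
have t0 : 0 < g k by rewrite (lt_trans _ t1).
have dE j : `|(delta (g k)^-1 x) 0 j| = (g k)^-1 `^ wt j * g j `^ wt j.
  by rewrite mxE normrM gE ger0_norm// powR_ge0.
have d1 : `|delta (g k)^-1 x| = 1.
  apply/eqP; rewrite eq_le; apply/andP; split.
    apply: row_norm_le => // j; rewrite dE -powRM ?invr_ge0 ?(ltW t0) ?powR_ge0//.
    rewrite [leRHS](one (wt j)); apply: ge0_ler_powR; rewrite ?nnegrE//.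
    - by rewrite (le_trans _ (hg_weight_ge1 G j)).
    - by rewrite mulr_ge0 ?invr_ge0 ?powR_ge0.
    - by rewrite mulrC ler_pdivrMr// mul1r.
  have := coord_norm_le (delta (g k)^-1 x) k.
  by rewrite dE -powRM ?invr_ge0 ?(ltW t0)// mulVf ?gt_eqF// powR1.
have := m0_lb d1; rewrite (hnorm_dilation hN) ?invr_gt0// leNgt => /negP; apply.
rewrite mulrC ltr_pdivrMr//; apply: le_lt_trans Nx _.
by rewrite ltr_pMr.
Qed.

Lemma hnorm_box r x i : 0 <= r -> N x <= r * m0 -> `|x 0 i| <= r `^ wt i.
Proof.
rewrite le_eqVlt => /predU1P[<-|r0] Nx.
  rewrite mul0r in Nx.
  have /(hnorm_eq0 hN) -> : N x = 0 by apply/eqP; rewrite eq_le Nx (hnorm_ge0 hN).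
  by rewrite mxE normr0 powR_ge0.
have H : `|(delta r^-1 x) 0 i| <= 1.
  apply: hnorm_unit_box; rewrite (hnorm_dilation hN) ?invr_gt0//.
  by rewrite ler_pdivrMl.
move: H; rewrite mxE normrM ger0_norm ?powR_ge0//.
rewrite -powR_inv1 ?(ltW r0)// -powRrM mulN1r powRN.
by rewrite ler_pdivrMl ?powR_gt0// mulr1.
Qed.

Lemma mul_continuous : continuous (fun p : V * V => mul p.1 p.2).
Proof. move=> p; exact/differentiable_continuous/(mul_differentiable (hg_lie_group G)). Qed.

Lemma hnorm_mul_bounded : exists2 M, 0 < M &
  forall x y : V, (forall i, `|x 0 i| <= 1) -> (forall i, `|y 0 i| <= 1) -> N (mul x y) <= M.
Proof.
pose g (p : V * V) := N (mul p.1 p.2).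
have cg : continuous g.
  move=> p; apply: (@continuous_comp _ _ _ (fun p : V * V => mul p.1 p.2) N).
    exact: mul_continuous.
  exact: (hnorm_continuous hN).
pose S := [set x : V | `|x| <= 1].
have cS : compact S.
  apply: bounded_closed_compact.
    by exists 1; split => // M M1 x /= x1; exact: le_trans x1 (ltW M1).
  have -> : S = (Num.norm : V -> R) @^-1` [set x : R | x <= 1] by [].
  by apply: preimage_closed; [move=> ? _; exact: norm_continuous|exact: closed_le].
have S0 : S `*` S !=set0 by exists (0, 0); rewrite /S/= normr0.
have [c _ Nc] := compact_EVT_max S0 (compact_setX cS cS) (continuous_subspaceT cg).
(* 1 is added only to make the bound positive *)
exists (g c + 1); first by rewrite ltr_wpDl// /g (hnorm_ge0 hN).
move=> x y x1 y1; have := Nc (x, y); rewrite /g /= => H.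
rewrite (le_trans (H _)) ?lerDl// inE /S/=; split; exact: row_norm_le.
Qed.

(** By homogeneity the two factors can be shrunk to the unit cube, where the norm
    of the product is bounded by compactness. *)
Lemma hnorm_quasi_triangle : exists2 c, 1 <= c & forall x y, N (mul x y) <= c * (N x + N y).
Proof.
have [M M0 HM] := hnorm_mul_bounded.
exists (1 + M / m0); first by rewrite lerDl divr_ge0// ltW.
move=> x y; set s := N x + N y.
have Nx0 := hnorm_ge0 hN x.
have Ny0 := hnorm_ge0 hN y.
have s0 : 0 <= s by rewrite addr_ge0.
have [sE|sn0] := eqVneq s 0.
  have /andP[/eqP xE /eqP yE] : (N x == 0) && (N y == 0) by rewrite -paddr_eq0// -/s sE.
  rewrite ((hnorm_eq0 hN x).1 xE) ((hnorm_eq0 hN y).1 yE) hg_mul0x hnorm0.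
  by rewrite sE mulr0.
have sp : 0 < s by rewrite lt_neqAle eq_sym sn0.
pose r := s / m0.
have r0 : 0 < r by rewrite divr_gt0.
have rV0 : 0 < r^-1 by rewrite invr_gt0.
have box z : N z <= s -> forall i, `|(delta r^-1 z) 0 i| <= 1.
  move=> zs i; apply: hnorm_unit_box; rewrite (hnorm_dilation hN)//.
  by rewrite ler_pdivrMl// /r divfK// gt_eqF.
have := HM _ _ (box x _) (box y _); rewrite -dilation_mul// (hnorm_dilation hN)//.
rewrite /s lerDl lerDr => /(_ Ny0 Nx0); rewrite ler_pdivrMl// => /le_trans; apply.
have -> : (1 + M / m0) * (N x + N y) = s + r * M by rewrite /r /s; ring.
by rewrite lerDr.
Qed.

Lemma hmul_opp_continuous x : continuous (fun y : V => N (mul x (- y))).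
Proof.
move=> y; apply: (@continuous_comp _ _ _ (fun y : V => mul x (- y)) N); last exact: (hnorm_continuous hN).
apply: (@continuous_comp _ _ _ (fun y : V => (x, - y)) (fun p : V * V => mul p.1 p.2));
  last exact: mul_continuous.
apply: differentiable_continuous; apply: differentiable_pair; first exact: differentiable_cst.
exact: differentiableN.
Qed.

Lemma measurable_hmul_ball x s : measurable [set y : V | N (mul x (- y)) <= s].
Proof.
have -> : [set y : V | N (mul x (- y)) <= s] = ~` ((fun y : V => N (mul x (- y))) @^-1` [set t | s < t]).
  by apply/seteqP; split => y /=; rewrite leNgt => /negP.
apply: measurableC; apply: open_measurable_row.
by move/continuousP : (@hmul_opp_continuous x); apply; exact: open_gt.
Qed.

(** If two points of the set agree in the coordinates before i, then, the group law
    being triangular, their i-th coordinates differ as those of the two products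
    x (- y), which lie in a box of half-side r^(wt i). *)
Lemma hmul_ball_volume x r : 0 <= r ->
  (lebesgue_row R n.+1 [set y : V | N (mul x (- y)) <= r * m0]%R <= (4 ^+ n.+1 * r `^ Q)%:E)%E.
Proof.
move=> r0.
have -> : 4 ^+ n.+1 * r `^ Q = \prod_i (2 * (2 * r `^ wt i)).
  rewrite -prod_powR//; last exact: hg_weight_ge1.
  rewrite -{1}(card_ord n.+1) -prodr_const -big_split/=.
  by apply: eq_bigr => i _; ring.
apply: lebesgue_row_le; first exact: measurable_hmul_ball.
  by move=> i; rewrite mulr_ge0// powR_ge0.
move=> y y' /= Ay Ay' i yy'.
have T := @mul_triangular _ _ G x (- y) (- y') i.
have {}T : (mul x (- y)) 0 i - (- y) 0 i = (mul x (- y')) 0 i - (- y') 0 i.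
  by apply: T => j ji; rewrite !mxE yy'.
have := hnorm_box i r0 Ay; have := hnorm_box i r0 Ay'.
move: T; rewrite [in - (- y) 0 i]mxE [in - (- y') 0 i]mxE.
move: (mul x (- y)) (mul x (- y')) => z z' T.
rewrite !ler_norml => /andP[? ?] /andP[? ?]; apply/andP; split; lra.
Qed.

End norm.

(** * The convolution estimate *)
Section decay.
Variable R : realType.
Implicit Types a b s t u v K : R.

Lemma powRN_le a b s : 0 < b -> b <= a -> 0 <= s -> a `^ (- s) <= b `^ (- s).
Proof.
move=> b0 ba s0; have a0 : 0 < a by exact: lt_le_trans ba.
rewrite !powRN lef_pV2 ?posrE ?powR_gt0//.
by apply: ge0_ler_powR; rewrite ?nnegrE// ltW.
Qed.

Lemma powRX a b k : 0 <= a -> (a ^+ k) `^ b = (a `^ b) ^+ k.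
Proof.
by move=> a0; rewrite -powR_mulrn// -powRrM mulrC powRrM powR_mulrn ?powR_ge0.
Qed.

Lemma decay_le1 u s : 0 <= u -> 0 <= s -> (1 + u) `^ (- s) <= 1.
Proof.
move=> u0 s0; have := @powRN_le (1 + u) 1 s ltr01.
by rewrite powR1 lerDl; apply.
Qed.

Lemma decay_scale K u v s : 1 <= K -> 0 <= u -> 0 <= v -> v <= K * u -> 0 <= s ->
  (1 + u) `^ (- s) <= K `^ s * (1 + v) `^ (- s).
Proof.
move=> K1 u0 v0 vKu s0.
have K0 : 0 < K by exact: lt_le_trans K1.
have v1 : 0 < 1 + v by rewrite ltr_wpDr.
have u1 : 0 < 1 + u by rewrite ltr_wpDr.
have -> : K `^ s * (1 + v) `^ (- s) = ((1 + v) / K) `^ (- s).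
  rewrite powRM ?invr_ge0 ?ltW// mulrC; congr (_ * _).
  by rewrite -powR_inv1 ?ltW// -powRrM mulrNN mul1r.
apply: powRN_le => //; first by rewrite divr_gt0.
by rewrite ler_pdivrMr// mulrDl mul1r lerD// mulrC.
Qed.

(** The exponent k is the index of the first dyadic interval [0, 2^k] that
    contains t. *)
Lemma decay_dyadic t s : 0 <= t -> 0 <= s -> exists k : nat, t <= 2 ^+ k /\
  (1 + t) `^ (- s) <= 2 `^ s * (2 `^ (- s)) ^+ k.
Proof.
move=> t0 s0.
have ex : exists k : nat, t <= 2 ^+ k.
  exists (Num.bound t); apply: (@le_trans _ _ (Num.bound t)%:R).
    by rewrite ltW// archi_boundP.
  by rewrite -natrX ler_nat ltnW// ltn_expl.
case: (ex_minnP ex) => k tk kmin; exists k; split => //.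
case: k tk kmin => [|k] tk kmin.
  rewrite expr0 mulr1 (@le_trans _ _ 1)//.
    exact: decay_le1.
  by rewrite -[leLHS](powRr0 (2:R)); apply: ler_powR => //; rewrite ler1n.
have t2 : 2 ^+ k <= t.
  rewrite leNgt; apply/negP => tk'; have := kmin k (ltW tk').
  by rewrite ltnn.
have -> : 2 `^ s * 2 `^ (- s) ^+ k.+1 = (2 ^+ k) `^ (- s) :> R.
  rewrite exprS mulrA -powRD ?subrr ?powRr0 ?mul1r; last by rewrite pnatr_eq0 implybT.
  by rewrite powRX.
apply: powRN_le => //.
by rewrite (le_trans t2)// lerDr.
Qed.

End decay.

Section convolution_bound.
Variables (R : realType) (n : nat) (G : homogeneous_group R n).
Local Notation V := 'rV[R]_n.+1.
Local Notation mul := (hg_mul G).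
Local Notation Q := (homogeneous_dim G).
Local Notation vol := (lebesgue_row R n.+1).
Variable N : V -> R.
Hypothesis hN : is_homogeneous_norm G N.

Lemma measurable_decay (f : V -> R) (l s : R) : continuous f ->
  measurable_fun [set: V] (fun y => (1 + l * f y) `^ s).
Proof.
move=> cf; have mf := continuous_measurable_row cf.
apply: (@measurableT_comp _ _ _ _ _ _ (fun t : R => t `^ s)).
  exact: measurable_powR.
by apply: measurable_funD => //; apply: measurable_funM.
Qed.

Variable m0 : R.
Hypothesis m0_gt0 : 0 < m0.
Hypothesis m0_lb : forall x : V, `|x| = 1 -> m0 <= N x.

(** The integrand is at most a geometric combination, of ratio 2^(-s), of
    indicators of balls of radius 2^k / l, whose volumes grow like 2^(k Q);
    s > Q makes the series converge. *)
Lemma integral_decay_le (s : R) : Q < s -> exists2 C, 0 < C & forall l x, 0 < l ->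
  (\int[vol]_y ((1 + l * N (mul x (- y))) `^ (- s))%:E <= (C * l `^ (- Q))%:E)%E.
Proof.
move=> Qs.
have Q0 := homogeneous_dim_gt0 G.
have s0 : 0 < s := lt_trans Q0 Qs.
pose z : R := 2 `^ (- s) * 2 `^ Q.
have z0 : 0 < z by rewrite mulr_gt0// powR_gt0.
have z1 : z < 1.
  rewrite /z -powRD; last by rewrite pnatr_eq0 implybT.
  rewrite -[ltRHS](powRr0 (2:R)) /powR pnatr_eq0/= ltr_expR ltr_pM2r; last first.
    by rewrite ln_gt0// ltr1n.
  by rewrite addrC subr_lt0.
pose D : R := 2 `^ s * 4 ^+ n.+1 * m0 `^ (- Q).
have D0 : 0 < D by rewrite !mulr_gt0 ?powR_gt0 ?exprn_gt0.
exists (D / (1 - z)); first by rewrite divr_gt0// subr_gt0.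
move=> l x l0.
pose A k := [set y : V | N (mul x (- y)) <= 2 ^+ k / (l * m0) * m0].
have AE k y : A k y <-> l * N (mul x (- y)) <= 2 ^+ k.
  rewrite /A/= invfM mulrA divfK ?gt_eqF// ler_pdivlMr// [_ * l]mulrC; exact.
have mA k : measurable (A k) by exact: measurable_hmul_ball.
pose f k (y : V) : \bar R := ((2 `^ s * (2 `^ (- s)) ^+ k)%:E * (\1_(A k) y)%:E)%E.
have f0 k y : (0 <= f k y)%E.
  by rewrite /f -EFinM lee_fin !mulr_ge0 ?exprn_ge0 ?powR_ge0.
have mI k : measurable_fun [set: V] (fun y => (\1_(A k) y)%:E : \bar R).
  by apply/measurable_EFinP; exact: measurable_indic.
have mf k : measurable_fun [set: V] (f k).
  exact: measurable_funeM.
apply: (@le_trans _ _ (\int[vol]_y \sum_(0 <= k <oo) f k y)%E).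
  apply: ge0_le_integral => //.
  - by move=> y _; rewrite lee_fin powR_ge0.
  - apply/measurable_EFinP; apply: measurable_decay; exact: hmul_opp_continuous.
  - by apply: ge0_emeasurable_sum => //.
  - move=> y _.
    have t0 : 0 <= l * N (mul x (- y)) by rewrite mulr_ge0 ?(hnorm_ge0 hN)// ltW.
    have [k [tk dk]] := decay_dyadic t0 (ltW s0).
    apply: (@le_trans _ _ (\sum_(0 <= i < k.+1) f i y)%E); last exact: nneseries_lim_ge.
    rewrite big_nat_recr//=; apply: (@le_trans _ _ (f k y)).
      rewrite /f indicE mem_set; last exact/AE.
      by rewrite mule1 lee_fin.
    by rewrite leeDr// sume_ge0.
rewrite integral_nneseries//.
apply: lime_le; first by apply: is_cvg_nneseries => k _ _; exact: integral_ge0.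
near=> k.
apply: (@le_trans _ _ (\sum_(0 <= i < k) (D * l `^ (- Q) * z ^+ i)%:E)%E).
  apply: lee_sum => i _.
  rewrite /f ge0_integralZl//.
  rewrite integral_indic// setIT.
  have r0 : 0 <= 2 ^+ i / (l * m0) by rewrite divr_ge0 ?exprn_ge0// mulr_ge0// ltW.
  have H := hmul_ball_volume hN m0_gt0 m0_lb x r0.
  have a0 : (0 <= (2 `^ s * (2 `^ (- s)) ^+ i)%:E)%E.
    by rewrite lee_fin mulr_ge0 ?exprn_ge0 ?powR_ge0.
  apply: (le_trans (lee_wpmul2l a0 H)).
  rewrite -EFinM lee_fin.
  rewrite powRM ?exprn_ge0 ?invr_ge0 ?mulr_ge0 ?(ltW l0) ?(ltW m0_gt0)//.
  rewrite invfM powRM ?invr_ge0 ?(ltW l0) ?(ltW m0_gt0)//.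
  rewrite -!powR_inv1 ?(ltW l0) ?(ltW m0_gt0)// -!powRrM !mulN1r.
  rewrite /D /z exprMn.
  have -> : (2 ^+ i) `^ Q = (2 `^ Q) ^+ i :> R.
    by rewrite powRX.
  by rewrite le_eqVlt; apply/orP; left; apply/eqP; ring.
rewrite sumEFin lee_fin.
have := @geometric_le_lim R k (D * l `^ (- Q)) z.
rewrite ger0_norm ?(ltW z0)// => H.
have -> : D / (1 - z) * l `^ (- Q) = D * l `^ (- Q) / (1 - z) by ring.
apply: H => //; by rewrite mulr_ge0 ?powR_ge0// ltW.
Unshelve. all: by end_near. Qed.

(** With z = x (- y), either N x <= 2 c N y, and the second factor of the integrand
    is comparable to its value at x; or N x <= 2 c N z and N y <= N x, and the first
    factor is comparable to (1 + l N x)^(-s) on a ball of volume about (N x)^Q. *)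
Lemma convolution_decay_le (s t : R) : 0 < t -> s = t + Q -> exists2 C, 0 < C &
  forall l m x, 0 < m -> m <= l ->
  (\int[vol]_y ((1 + l * N (mul x (- y))) `^ (- s) * (1 + m * N y) `^ (- t))%:E <=
    (C * l `^ (- Q) * (1 + m * N x) `^ (- t))%:E)%E.
Proof.
move=> t0 sE.
have Q0 := homogeneous_dim_gt0 G.
have Qs : Q < s by rewrite sE ltrDr.
have s0 : 0 < s := lt_trans Q0 Qs.
have [c c1 Hc] := hnorm_quasi_triangle hN m0_gt0 m0_lb.
have [C1 C10 HC1] := integral_decay_le Qs.
(* K N y >= N x defines the region where the second factor is comparable to its
   value at x; a1 and a2 are the constants of the two regions *)
pose K := 2 * c.
have K1 : 1 <= K by rewrite /K; lra.
have K0 : 0 < K by exact: lt_le_trans K1.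
exists (K `^ t * C1 + K `^ s * (4 ^+ n.+1 * m0 `^ (- Q))).
  by rewrite addr_gt0// !mulr_gt0 ?powR_gt0 ?exprn_gt0.
move=> l m x mp ml.
have lp : 0 < l := lt_le_trans mp ml.
have Nx0 := hnorm_ge0 hN x.
pose P (y : V) := (1 + l * N (mul x (- y))) `^ (- s).
pose A := [set y : V | N (mul 0 (- y)) <= N x / m0 * m0].
have AE y : A y <-> N y <= N x.
  by rewrite /A/= hg_mul0x (hnormN hN) divfK ?gt_eqF//; exact.
have mA : measurable A by exact: measurable_hmul_ball.
pose a1 := K `^ t * (1 + m * N x) `^ (- t).
pose a2 := K `^ s * (1 + l * N x) `^ (- s).
have a10 : 0 <= a1 by rewrite mulr_ge0 ?powR_ge0.
have a20 : 0 <= a2 by rewrite mulr_ge0 ?powR_ge0.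
have mP : measurable_fun [set: V] (fun y => (P y)%:E : \bar R).
  by apply/measurable_EFinP; apply: measurable_decay; exact: hmul_opp_continuous.
have mI : measurable_fun [set: V] (fun y => (\1_A y)%:E : \bar R).
  by apply/measurable_EFinP; exact: measurable_indic.
apply: (@le_trans _ _ (\int[vol]_y (a1%:E * (P y)%:E + a2%:E * (\1_A y)%:E))%E).
  apply: ge0_le_integral => //.
  - by move=> y _; rewrite lee_fin mulr_ge0 ?powR_ge0.
  - apply/measurable_EFinP; apply: measurable_funM.
      by apply: measurable_decay; exact: hmul_opp_continuous.
    by apply: measurable_decay; exact: (hnorm_continuous hN).
  - by apply: emeasurable_funD; exact: measurable_funeM.
  - move=> y _; rewrite -!EFinM -EFinD lee_fin -/(P y).
    have P0 : 0 <= P y by exact: powR_ge0.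
    have Ny0 := hnorm_ge0 hN y.
    have Nz0 := hnorm_ge0 hN (mul x (- y)).
    have tri : N x <= c * (N (mul x (- y)) + N y).
      have := Hc (mul x (- y)) y.
      by rewrite -(exp_mulA (hg_lie_group G)) (exp_mulNx (hg_exp G)) (exp_mulx0 (hg_lie_group G) (hg_exp G)).
    have [far|near] := leP (N x) (K * N y).
      apply: (@le_trans _ _ (a1 * P y)); last by rewrite lerDl mulr_ge0.
      rewrite mulrC ler_wpM2r// /a1; apply: decay_scale => //; rewrite ?mulr_ge0 ?(ltW mp) ?(ltW t0)//.
      by rewrite mulrCA ler_wpM2l// ltW.
    apply: (@le_trans _ _ (a2 * \1_A y)); last by rewrite lerDr mulr_ge0.
    rewrite indicE mem_set; last first.
      apply/AE; apply: le_trans (ltW near).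
      by rewrite ler_peMl.
    rewrite mulr1 (@le_trans _ _ (P y))//.
      by rewrite ler_piMr// decay_le1// ?mulr_ge0 ?(ltW mp) ?(ltW t0).
    rewrite /a2; apply: decay_scale => //; rewrite ?mulr_ge0 ?(ltW lp) ?(ltW s0)//.
    rewrite mulrCA ler_wpM2l ?(ltW lp)//.
    by move: tri near; rewrite /K; nra.
rewrite ge0_integralD//; last 4 first.
- by move=> y _; rewrite -EFinM lee_fin mulr_ge0// powR_ge0.
- exact: measurable_funeM.
- by move=> y _; rewrite -EFinM lee_fin mulr_ge0.
- exact: measurable_funeM.
rewrite !ge0_integralZl//; last 1 first.
  by move=> y _; rewrite lee_fin powR_ge0.
rewrite integral_indic// setIT.
have Nm0 : 0 <= N x / m0 by rewrite divr_ge0// ltW.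
have H1 := lee_wpmul2l (_ : 0 <= a1%:E)%E (HC1 l x lp).
have H2 := lee_wpmul2l (_ : 0 <= a2%:E)%E (hmul_ball_volume hN m0_gt0 m0_lb 0 Nm0).
apply: (le_trans (leeD (H1 _) (H2 _))); rewrite ?lee_fin//.
have a2le : a2 * (4 ^+ n.+1 * (N x / m0) `^ Q) <=
   K `^ s * (4 ^+ n.+1 * m0 `^ (- Q)) * l `^ (- Q) * (1 + m * N x) `^ (- t).
  have lN0 : 0 <= l * N x by rewrite mulr_ge0// ltW.
  have u0 : 0 < 1 + l * N x by rewrite ltr_wpDr.
  (* the volume (N x)^Q costs Q powers of 1 + l N x, which is exactly s - t *)
  have NE : N x `^ Q <= l `^ (- Q) * (1 + l * N x) `^ Q.
    have -> : N x `^ Q = l `^ (- Q) * (l * N x) `^ Q.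
      by rewrite powRM ?(ltW lp)// powRN mulKf// gt_eqF// powR_gt0.
    rewrite ler_wpM2l ?powR_ge0//; apply: ge0_ler_powR; rewrite ?nnegrE ?(ltW Q0) ?(ltW u0)//.
    by rewrite lerDr.
  have uE : (1 + l * N x) `^ (- s) * (1 + l * N x) `^ Q = (1 + l * N x) `^ (- t).
    rewrite -powRD; first by congr (_ `^ _); rewrite sE; ring.
    by apply/implyP => _; rewrite gt_eqF.
  have ule : (1 + l * N x) `^ (- t) <= (1 + m * N x) `^ (- t).
    apply: powRN_le; last exact: ltW.
      by rewrite ltr_wpDr// mulr_ge0// ltW.
    by rewrite lerD2l ler_wpM2r.
  have mE : (N x / m0) `^ Q = N x `^ Q * m0 `^ (- Q).
    rewrite powRM ?invr_ge0 ?(ltW m0_gt0)//; congr (_ * _).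
    by rewrite -powR_inv1 ?(ltW m0_gt0)// -powRrM mulN1r.
  rewrite mE /a2.
  apply: (@le_trans _ _ (K `^ s * (4 ^+ n.+1 * m0 `^ (- Q)) *
     ((1 + l * N x) `^ (- s) * (l `^ (- Q) * (1 + l * N x) `^ Q)))).
    rewrite [leLHS](_ : _ = K `^ s * (4 ^+ n.+1 * m0 `^ (- Q)) *
      ((1 + l * N x) `^ (- s) * N x `^ Q)); last by ring.
    rewrite ler_wpM2l ?mulr_ge0 ?powR_ge0 ?exprn_ge0//.
    by rewrite ler_wpM2l ?powR_ge0.
  rewrite [(1 + l * N x) `^ (- s) * _]mulrCA uE [leLHS]mulrA.
  by rewrite ler_wpM2l// !mulr_ge0 ?powR_ge0 ?exprn_ge0.
rewrite [leRHS](_ : _ = a1 * (C1 * l `^ (- Q)) +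
   K `^ s * (4 ^+ n.+1 * m0 `^ (- Q)) * l `^ (- Q) * (1 + m * N x) `^ (- t)).
  by rewrite lerD2l.
by rewrite /a1; ring.
Qed.

End convolution_bound.

Theorem lemma16 (R : realType) (n : nat) (G : homogeneous_group R n)
    (N : 'rV[R]_n.+1 -> R) (hN : is_homogeneous_norm G N)
    (I J : R) (hJ : 0 < J) (hI : I = J + homogeneous_dim G) :
  exists C : R, 0 < C /\
    forall sigma nu : int, nu <= sigma ->
    forall x : 'rV[R]_n.+1,
      (convolution G (Phi N I sigma) (Phi N J nu) x <=
       (C * 2%:R `^ (- (sigma%:~R * homogeneous_dim G)) * Phi N J nu x)%:E)%E.
Proof.
have [m0 m0_gt0 m0_lb] := hnorm_sphere_lb hN.
have [C C0 HC] := convolution_decay_le hN m0_gt0 m0_lb hJ hI.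
exists C; split => // sigma nu nusigma x.
have p2 (z : int) : 0 < 2%:R ^ z :> R by rewrite exprz_gt0.
have le2 : 2%:R ^ nu <= 2%:R ^ sigma :> R by rewrite ler_eXz2l// ltr1n.
have -> : 2%:R `^ (- (sigma%:~R * homogeneous_dim G)) =
    (2%:R ^ sigma) `^ (- homogeneous_dim G) :> R.
  by rewrite -powR_intmul// -powRrM mulrN.
rewrite /convolution /Phi.
under eq_integral do rewrite hg_invE.
exact: HC.
Qed.
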